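(* For all integers $n\ge 0$, \begin{align*} \bar{p}(80n+8)&\equiv \bar{p}(80n+72)\equiv 0\pmod{100},\\ \bar{p}(80n+52)&\equiv \bar{p}(80n+68)\equiv 0\pmod{200}. \end{align*}
   Context: An overpartition of a nonnegative integer $n$ is a partition of $n$ in which the first occurrence of each part size may or may not be overlined (marked). $\bar{p}(n)$ denotes the number of overpartitions of $n$ (for example $\bar{p}(3)=8$). Its generating function is $$\sum_{n=0}^{\infty}\bar{p}(n)q^n = \frac{(q^2;q^2)_{\infty}}{(q;q)_{\infty}^2},$$ where $(q^a;q^b)_{\infty} := \prod_{m=0}^{\infty}(1-q^{bm+a})$. *)

(* Defs.v *)
From mathcomp Require Import all_boot.

Set Implicit Arguments.
Unset Strict Implicit.
Unset Printing Implicit Defensive.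

(* An overpartition is the weakly decreasing sequence of its parts, each paired
   with a boolean telling whether that occurrence is overlined; an overlined
   part must not occur earlier in the sequence. *)
Definition is_overpartition (n : nat) (s : seq (nat * bool)) : bool :=
  let p := unzip1 s in
  [&& sorted geq p, all (leq 1) p, sumn p == n &
      all (fun i => nth false (unzip2 s) i ==> (nth 0 p i \notin take i p))
          (iota 0 (size s))].

(* The bounds by n on the number of parts and on their sizes lose nothing (see
   [overpartition_bounds]); they only provide a finite type to count in. *)
Definition overpartition_number (n : nat) : nat :=
  #|[set s : {bseq n of 'I_n.+1 * bool} |
      is_overpartition n [seq (val x.1, x.2) | x <- s]]|.

Lemma overpartition_bounds (n : nat) (s : seq (nat * bool)) :
  is_overpartition n s -> size s <= n /\ all (fun x => x.1 <= n) s.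
Proof.
case/and4P=> _ + /eqP <- _; elim: s => [|[a b] s IHs] //= /andP[a_gt0 /IHs[szs alls]].
split; first by rewrite -add1n leq_add.
rewrite leq_addr /=; apply: sub_all alls => x /leq_trans; apply; exact: leq_addl.
Qed.

Lemma overpartition_numberE (n : nat) (l : seq (seq (nat * bool))) :
    uniq l -> (forall s, (s \in l) = is_overpartition n s) ->
  overpartition_number n = size l.
Proof.
move=> uniq_l mem_l; rewrite /overpartition_number.
set A := [set s | _].
pose f (s : {bseq n of 'I_n.+1 * bool}) := [seq (val x.1, x.2) | x <- s].
have f_inj : injective f.
  move=> s t /inj_map eq_st; apply/val_inj/eq_st => -[i b] [j c] /= [ij ->].
  by rewrite (val_inj ij).
rewrite cardE -(size_map f); apply: perm_size; apply: uniq_perm => //.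
  by rewrite map_inj_uniq ?enum_uniq.
move=> s; rewrite mem_l; apply/mapP/idP => [[t + ->]|over_s].
  by rewrite mem_enum inE.
have [szs alls] := overpartition_bounds over_s.
pose t := [seq (inord x.1 : 'I_n.+1, x.2) | x <- s].
have szt : size t <= n by rewrite size_map.
have ft : f (Bseq szt) = s.
  rewrite /f /= /t -map_comp -[RHS]map_id; apply/eq_in_map => -[a b] /(allP alls) /= ?.
  by rewrite inordK.
by exists (Bseq szt); rewrite ?ft // mem_enum inE -/(f _) ft.
Qed.

(* Main.v *)
Require Import Defs.
From HB Require Import structures.
From mathcomp Require Import all_boot all_order all_algebra.
From mathcomp Require Import boolp.
From mathcomp Require Import ring lra zify.

(** Let P be the generating function of overpartitions, f_k the product of all
1 - q^(km), phi(q) the sum of q^(n^2) over all integers n, psi(q) the sum of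
q^(n(n+1)/2) over n >= 0, and S(q) the sum of sigma_3(n) q^n.  Counting gives
P = f_2 / f_1^2, and Gauss's identity phi(-q) = f_1^2 / f_2 turns this into
P phi(-q) = 1 ([overpartitions_phi]).

Modulo 4 and 8: if phi(-q) = 1 + 2t, then P = 1 - 2t + 4t^2 modulo 8, where t is
supported on the squares and t^2 is even away from the doubles of squares.
Squares are 0, 1 or 4 modulo 5, which excludes all four progressions, and a
residue modulo 8 excludes the doubles of squares from the last two.

Modulo 25: put a = phi(q)^4 and b = phi(-q)^4, so that a - b = 16 q psi(q^2)^4.
Dissecting P twice by means of phi(q) phi(-q) = phi(-q^2)^2 and
phi(q) = phi(q^4) + 2q psi(q^8) writes the generating functions of the
overpartitions of 16k + 4 and of 16k + 8 as theta monomials times a cubic form in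
a and a - b, divided by b^4 ([section16_overpartitions]).  Modulo 25 these cubic
forms factor, as a G and (a - b) G' with quadratic forms G and G'.  The eight
squares theorem expresses a^2, ab and b^2 linearly in S(q), S(q^2), S(q^4), and
shows that G and G' are constant modulo 5.  On the other hand
(1 - x)^5 = (1 - x^5) (1 - 5 sum n^3 x^n) modulo 25, hence
f_1^5 = f_5 (1 - 5 S(q)) modulo 25 ([euler_pow5]).  After every fifth power of a
product has been replaced in this way, the multiples of S cancel against those in
G and G', and the two generating functions are f_1 and q f_1 times series in q^5
([overpartitions_16n4_mod25], [overpartitions_16n8_mod25]).  By the pentagonal
number theorem the exponents of f_1 are 0, 1 or 2 modulo 5.  So the coefficients
of index k vanish modulo 25 for k = 3, 4 modulo 5 in the first case, which gives
80n + 52 and 80n + 68, and for k = 0, 4 in the second, which gives 80n + 8 and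
80n + 72.

The eight squares theorem is obtained from Liouville's method.  The shear
(a, b, x, y) -> (a, a + b, x - y, y) preserves ax + by; it yields an identity for
sums of f(a - b) - f(a + b) over the solutions of ax + by = n ([liouville]).  With
f(k) = k^2 this is Ramanujan's differential equation for the sum of
sigma_1(n) q^n, and with f(k) = (-1)^k k^2 a companion at level 2.  Together they
show that q psi(q^2)^4 and the sum of sigma_1(n) q^n over odd n satisfy the same
first order differential equation, so they are equal ([psi4_sigma_odd]).
Comparing logarithmic derivatives of a, b and a - b gives the four squares
theorem, and one more differentiation gives a^2 - 2ab.  Finally ab is b^2 at q^2,
so that this determines b^2 recursively ([twist_phi8_eisenstein]). *)

Set Implicit Arguments.
Unset Strict Implicit.
Unset Printing Implicit Defensive.

Import Order.TTheory GRing.Theory Num.Theory.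
Local Open Scope ring_scope.

(** * Formal power series over the integers *)

(** Wrapping the coefficient function keeps the convolution product apart from
the pointwise one on functions. *)
Record series := Series { coefs :> nat -> int }.

Lemma seriesP (f g : series) : (forall n, f n = g n) -> f = g.
Proof. by case: f g => [f] [g] /= fg; congr Series; apply/funext. Qed.

Arguments coefs : simpl never.

HB.instance Definition _ := gen_eqMixin series.
HB.instance Definition _ := gen_choiceMixin series.

Definition series_add (f g : series) := Series (fun n => f n + g n).
Definition series_opp (f : series) := Series (fun n => - f n).
Definition series_const (c : int) := Series (fun n => if n is 0%N then c else 0).
Definition series_mul (f g : series) :=
  Series (fun n => \sum_(i < n.+1) f i * g (n - i)%N).

Fact series_addA : associative series_add.
Proof. by move=> f g h; apply: seriesP => n; apply: addrA. Qed.
Fact series_addC : commutative series_add.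
Proof. by move=> f g; apply: seriesP => n; apply: addrC. Qed.
Fact series_add0 : left_id (series_const 0) series_add.
Proof. by move=> f; apply: seriesP => -[|n]; apply: add0r. Qed.
Fact series_addN : left_inverse (series_const 0) series_opp series_add.
Proof. by move=> f; apply: seriesP => -[|n]; apply: addNr. Qed.

HB.instance Definition _ :=
  GRing.isZmodule.Build series series_addA series_addC series_add0 series_addN.

(** The ring laws are inherited from polynomials: the coefficients of a product
up to a given index only see finitely many coefficients of the factors. *)
Lemma series_mul_poly (n : nat) (f g : series) (p r : {poly int}) :
    (forall i, (i <= n)%N -> p`_i = f i) ->
    (forall i, (i <= n)%N -> r`_i = g i) ->
  forall i, (i <= n)%N -> (p * r)`_i = series_mul f g i.
Proof.
move=> pf rg i le_in; rewrite coefM; apply: eq_bigr => j _.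
by rewrite pf ?rg //; have := ltn_ord j; lia.
Qed.

Definition trunc n (f : series) : {poly int} := \poly_(i < n.+1) f i.
Lemma truncE n f i : (i <= n)%N -> (trunc n f)`_i = f i.
Proof. by move=> le_in; rewrite coef_poly ltnS le_in. Qed.

Lemma trunc_mul n f g i : (i <= n)%N -> (trunc n f * trunc n g)`_i = series_mul f g i.
Proof. by apply: series_mul_poly => j; apply: truncE. Qed.

Fact series_mulA : associative series_mul.
Proof.
move=> f g h; apply: seriesP => n.
transitivity (trunc n f * (trunc n g * trunc n h))`_n.
  by symmetry; apply: (series_mul_poly (n := n)) => // i; [apply: truncE | apply: trunc_mul].
rewrite mulrA; apply: (series_mul_poly (n := n)) => // i; [apply: trunc_mul | apply: truncE].
Qed.
Fact series_mulC : commutative series_mul.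
Proof.
by move=> f g; apply: seriesP => n; rewrite -(trunc_mul f g (leqnn n)) mulrC (trunc_mul g f).
Qed.
Fact series_mul1 : left_id (series_const 1) series_mul.
Proof.
move=> f; apply: seriesP => n; rewrite [LHS]big_ord_recl subn0 mul1r big1 ?addr0 //.
by move=> i _; rewrite mul0r.
Qed.
Fact series_mulD : left_distributive series_mul series_add.
Proof.
move=> f g h; apply: seriesP => n.
transitivity (\sum_(i < n.+1) (f i * h (n - i)%N + g i * h (n - i)%N)).
  by apply: eq_bigr => i _; rewrite -mulrDl.
exact: big_split.
Qed.
Fact series_1neq0 : series_const 1 != 0.
Proof. by apply/eqP => /(congr1 (fun f : series => f 0%N)). Qed.

HB.instance Definition _ := GRing.Zmodule_isComNzRing.Build series
  series_mulA series_mulC series_mul1 series_mulD series_1neq0.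

Lemma series0E n : (0 : series) n = 0. Proof. by case: n. Qed.
Lemma series1E n : (1 : series) n = (n == 0)%:R. Proof. by case: n. Qed.
Lemma seriesDE (f g : series) n : (f + g) n = f n + g n. Proof. by []. Qed.
Lemma seriesNE (f : series) n : (- f) n = - f n. Proof. by []. Qed.
Lemma seriesBE (f g : series) n : (f - g) n = f n - g n. Proof. by []. Qed.
Lemma seriesME (f g : series) n : (f * g) n = \sum_(i < n.+1) f i * g (n - i)%N.
Proof. by []. Qed.
Lemma seriesM0 (f g : series) : (f * g) 0%N = f 0%N * g 0%N.
Proof. by rewrite seriesME big_ord1. Qed.
Lemma seriesX0 (f : series) k : (f ^+ k) 0%N = f 0%N ^+ k.
Proof. by elim: k => // k IHk; rewrite !exprS seriesM0 IHk. Qed.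
Lemma series_sumE I r (P : pred I) (F : I -> series) n :
  (\sum_(i <- r | P i) F i) n = \sum_(i <- r | P i) F i n.
Proof.
by elim/big_rec2: _ => [|i _ y _ <-]; rewrite ?series0E ?seriesDE.
Qed.
Lemma seriesMnE (f : series) m n : (f *+ m) n = f n *+ m.
Proof. by elim: m => [|m IHm]; rewrite ?mulr0n ?series0E // !mulrS seriesDE IHm. Qed.
Lemma series_natE m n : (m%:R : series) n = (m * (n == 0))%:R.
Proof. by rewrite seriesMnE series1E -mulrnA mulnC. Qed.
Lemma series_natME m (f : series) n : (m%:R * f) n = m%:R * f n.
Proof. by rewrite mulr_natl seriesMnE mulr_natl. Qed.

(** * Substitutions, the Euler derivation and sections *)

Definition qv : series := Series (fun n => (n == 1)%:R).

Lemma qvE n : qv n = (n == 1)%:R. Proof. by []. Qed.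
Lemma qvM0 (f : series) : (qv * f) 0%N = 0.
Proof. by rewrite seriesM0 mul0r. Qed.
Lemma qvMS (f : series) n : (qv * f) n.+1 = f n.
Proof.
rewrite seriesME !big_ord_recl /= mul0r add0r mul1r subSS subn0 big1 ?addr0 //.
by move=> i _; rewrite mul0r.
Qed.
Lemma qvXM k (f : series) n : (qv ^+ k * f) n = if (k <= n)%N then f (n - k)%N else 0.
Proof.
elim: k n => [|k IHk] n; first by rewrite mul1r subn0.
by rewrite exprS -mulrA; case: n => [|n]; rewrite ?qvM0 // qvMS IHk.
Qed.
Lemma qvXE k n : (qv ^+ k) n = (n == k)%:R.
Proof.
rewrite -[_ ^+ _]mulr1 qvXM series1E; case: leqP => h; last by rewrite ltn_eqF.
by rewrite subn_eq0 eqn_leq h andbT.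
Qed.

(** [sub k], [twist] and [theta] are q -> q^k, q -> -q and q d/dq; [section m r]
keeps the coefficients of index mn + r. *)
Definition sub k (f : series) :=
  Series (fun n => if (k %| n)%N then f (n %/ k)%N else 0).
Definition twist (f : series) := Series (fun n => (-1) ^+ n * f n).
Definition theta (f : series) := Series (fun n => n%:R * f n).
Definition section m r (f : series) := Series (fun n => f (m * n + r)%N).

Arguments sub k%_N f.
Arguments section (m r)%_N f.

Lemma subE k f n : sub k f n = if (k %| n)%N then f (n %/ k)%N else 0.
Proof. by []. Qed.
Lemma twistE f n : twist f n = (-1) ^+ n * f n. Proof. by []. Qed.
Lemma thetaE f n : theta f n = n%:R * f n. Proof. by []. Qed.
Lemma sectionE m r f n : section m r f n = f (m * n + r)%N. Proof. by []. Qed.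
Definition series_opE := (subE, twistE, thetaE, sectionE).

Lemma sum_multiples (k N : nat) (F : nat -> int) : (0 < k)%N ->
  \sum_(0 <= i < N.+1 | (k %| i)%N) F i = \sum_(0 <= j < (N %/ k).+1) F (k * j)%N.
Proof.
move=> k_gt0; elim: N => [|N IHN].
  by rewrite div0n !big_mkord big_mkcond !big_ord1 dvdn0 muln0.
rewrite big_mkcond big_nat_recr //= -big_mkcond IHN.
case: (boolP (k %| N.+1)%N) => kN.
  have e : (N.+1 %/ k = (N %/ k).+1)%N by rewrite divnS // kN add1n.
  by rewrite e [RHS]big_nat_recr //= -e mulnC divnK.
have -> : (N.+1 %/ k = N %/ k)%N by rewrite divnS // (negbTE kN).
by rewrite addr0.
Qed.

(** Series in q^m are scalars for the extraction of a residue class modulo m. *)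
Lemma section_subM m r (f g : series) : (r < m)%N ->
  section m r (sub m f * g) = f * section m r g.
Proof.
move=> lt_rm; have m_gt0 : (0 < m)%N by lia.
apply: seriesP => n; rewrite !series_opE seriesME.
rewrite -(big_mkord xpredT (fun i => sub m f i * g (m * n + r - i)%N)).
rewrite (eq_bigr (fun i => if (m %| i)%N then f (i %/ m)%N * g (m * n + r - i)%N else 0));
  last by move=> i _; rewrite subE; case: ifP; rewrite ?mul0r.
rewrite -big_mkcond sum_multiples // mulnC divnMDl // divn_small // addn0 big_mkord.
apply: eq_bigr => i _; rewrite mulKn //; congr (_ * g _).
have := ltn_ord i; nia.
Qed.

Lemma section_sub m r (f : series) : (r < m)%N ->
  section m r (sub m f) = if r == 0%N then f else 0.
Proof.
move=> lt_rm; apply: seriesP => n; rewrite !series_opE.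
rewrite dvdn_addr ?dvdn_mulr // mulnC divnMDl ?(divn_small lt_rm) ?addn0; last by lia.
case: eqP => [->|/eqP r0]; rewrite ?dvdn0 // /dvdn modn_small // (negbTE r0).
by rewrite series0E.
Qed.

Lemma sub_section m (f g : series) : (0 < m)%N ->
    (forall r, (r < m)%N -> section m r f = if r == 0%N then g else 0) ->
  f = sub m g.
Proof.
move=> m_gt0 fg; apply: seriesP => n; rewrite !series_opE.
have /(congr1 (fun h : series => h (n %/ m)%N)) := fg _ (ltn_pmod n m_gt0).
rewrite !series_opE mulnC -divn_eq => ->; rewrite -/(dvdn m n).
by case: ifP; rewrite ?series0E.
Qed.

Fact sub_is_zmod_morphism k : zmod_morphism (sub k).
Proof.
by move=> f g; apply: seriesP => n; rewrite !(seriesBE, subE); case: ifP; rewrite ?subr0.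
Qed.
HB.instance Definition _ k :=
  GRing.isZmodMorphism.Build series series (sub k) (sub_is_zmod_morphism k).

Fact sub_is_monoid_morphism k : monoid_morphism (sub k).
Proof.
split.
  apply: seriesP => n; rewrite !series_opE !series1E; case: ifP => // kn; last first.
    by case: n kn => //; rewrite dvdn0.
  move: kn => /dvdnP[j ->]; case: k => [|k]; first by rewrite muln0.
  by rewrite mulnK // muln_eq0 orbF.
move=> f g; case: (posnP k) => [->|k_gt0].
  apply: seriesP => n; rewrite seriesME !series_opE dvd0n divn0; case: eqP => [->|/eqP n0].
    by rewrite seriesM0 big_ord1.
  rewrite big1 // => i _; rewrite !series_opE !dvd0n; case: eqP => [->|]; rewrite ?mul0r //.
  by rewrite subn0 (negbTE n0) mulr0.
symmetry; apply: sub_section => // r lt_rk; rewrite section_subM // section_sub //.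
by case: eqP => // _; rewrite mulr0.
Qed.
HB.instance Definition _ k :=
  GRing.isMonoidMorphism.Build series series (sub k) (sub_is_monoid_morphism k).

Lemma sub_add k f g : sub k (f + g) = sub k f + sub k g. Proof. exact: rmorphD. Qed.
Lemma sub_opp k f : sub k (- f) = - sub k f. Proof. exact: rmorphN. Qed.
Lemma sub_mul k f g : sub k (f * g) = sub k f * sub k g. Proof. exact: rmorphM. Qed.
Lemma sub_exp k f n : sub k (f ^+ n) = sub k f ^+ n. Proof. exact: rmorphXn. Qed.
Lemma sub_one k : sub k 1 = 1. Proof. exact: rmorph1. Qed.
Lemma sub_nat k n : sub k n%:R = n%:R. Proof. exact: rmorph_nat. Qed.
Definition sub_morph := (sub_one, sub_nat, sub_exp, sub_add, sub_opp, sub_mul).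

Lemma subM k l f : sub k (sub l f) = sub (k * l) f.
Proof.
case: k => [|k]; last first.
  apply: seriesP => n; rewrite !series_opE; case: (boolP (k.+1 %| n)%N) => [/dvdnP[j ->]|nk].
    by rewrite mulnK // (mulnC j) dvdn_pmul2l // divnMl.
  by case: ifP => // /(dvdn_trans (dvdn_mulr _ (dvdnn _))); rewrite (negbTE nk).
by apply: seriesP => n; rewrite !series_opE mul0n !dvd0n !divn0 dvdn0 div0n.
Qed.
Lemma sub1 f : sub 1 f = f.
Proof. by apply: seriesP => n; rewrite !series_opE dvd1n divn1. Qed.
Lemma sub_coef0 k f : sub k f 0%N = f 0%N.
Proof. by rewrite subE dvdn0 div0n. Qed.
Lemma sub_qv k : sub k.+1 qv = qv ^+ k.+1.
Proof.
apply: seriesP => n; rewrite qvXE subE; case: ifP => [/dvdnP[j ->]|nk].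
  by rewrite mulnK // -{2}[k.+1]mul1n eqn_pmul2r.
by case: eqP nk => // ->; rewrite dvdnn.
Qed.

Fact twist_is_zmod_morphism : zmod_morphism twist.
Proof. by move=> f g; apply: seriesP => n; rewrite !series_opE mulrBr. Qed.
HB.instance Definition _ :=
  GRing.isZmodMorphism.Build series series twist twist_is_zmod_morphism.
Fact twist_is_monoid_morphism : monoid_morphism twist.
Proof.
split=> [|f g]; apply: seriesP => n; rewrite !series_opE.
  by rewrite series1E; case: n => // n; rewrite mulr0.
rewrite !seriesME mulr_sumr; apply: eq_bigr => i _; rewrite !series_opE.
have -> : (-1) ^+ n = (-1) ^+ i * (-1) ^+ (n - i) :> int.
  by rewrite -exprD subnKC // -ltnS ltn_ord.
ring.
Qed.
HB.instance Definition _ :=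
  GRing.isMonoidMorphism.Build series series twist twist_is_monoid_morphism.

Lemma twist_add f g : twist (f + g) = twist f + twist g. Proof. exact: rmorphD. Qed.
Lemma twist_opp f : twist (- f) = - twist f. Proof. exact: rmorphN. Qed.
Lemma twist_mul f g : twist (f * g) = twist f * twist g. Proof. exact: rmorphM. Qed.
Lemma twist_exp f n : twist (f ^+ n) = twist f ^+ n. Proof. exact: rmorphXn. Qed.
Lemma twist_one : twist 1 = 1. Proof. exact: rmorph1. Qed.
Lemma twist_nat n : twist n%:R = n%:R. Proof. exact: rmorph_nat. Qed.
Definition twist_morph :=
  (twist_one, twist_nat, twist_exp, twist_add, twist_opp, twist_mul).

Lemma twistK : involutive twist.
Proof. by move=> f; apply: seriesP => n; rewrite !series_opE mulrA -expr2 sqrr_sign mul1r. Qed.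
Lemma twist_qv : twist qv = - qv.
Proof. by apply: seriesP => -[|[|n]]; rewrite seriesNE twistE !qvE /= ?mulr0 ?mulr1 ?oppr0. Qed.
Lemma twist_sub_even k f : ~~ odd k -> twist (sub k f) = sub k f.
Proof.
move=> k_even; apply: seriesP => n; rewrite !series_opE; case: ifP; rewrite ?mulr0 // => /dvdnP[j ->].
by rewrite -signr_odd oddM (negbTE k_even) andbF mul1r.
Qed.
Lemma twist_sub_odd k f : odd k -> twist (sub k f) = sub k (twist f).
Proof.
move=> k_odd; apply: seriesP => n; rewrite !series_opE; case: ifP; rewrite ?mulr0 // => /dvdnP[j ->].
rewrite mulnK; last by case: k k_odd.
by rewrite -signr_odd oddM k_odd andbT signr_odd.
Qed.

Fact theta_is_zmod_morphism : zmod_morphism theta.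
Proof. by move=> f g; apply: seriesP => n; rewrite !series_opE mulrBr. Qed.
HB.instance Definition _ :=
  GRing.isZmodMorphism.Build series series theta theta_is_zmod_morphism.
Lemma thetaM f g : theta (f * g) = theta f * g + f * theta g.
Proof.
apply: seriesP => n; rewrite seriesDE !series_opE !seriesME mulr_sumr -big_split /=.
apply: eq_bigr => i _; rewrite !thetaE; have -> : n%:R = i%:R + (n - i)%:R :> int.
  by rewrite -natrD subnKC // -ltnS ltn_ord.
ring.
Qed.
Lemma thetaD f g : theta (f + g) = theta f + theta g. Proof. exact: raddfD. Qed.
Lemma thetaB f g : theta (f - g) = theta f - theta g. Proof. exact: raddfB. Qed.
Lemma thetaN f : theta (- f) = - theta f. Proof. exact: raddfN. Qed.
Lemma theta1 : theta 1 = 0.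
Proof. by apply: seriesP => n; rewrite thetaE series1E series0E; case: n => *; rewrite ?mul0r ?mulr0. Qed.
Lemma theta_natM m f : theta (m%:R * f) = m%:R * theta f.
Proof. by rewrite !mulr_natl; exact: raddfMn. Qed.
Lemma thetaX f k : theta (f ^+ k) = k%:R * f ^+ k.-1 * theta f.
Proof.
elim: k => [|k IHk]; first by rewrite expr0 !mul0r theta1.
by rewrite exprS thetaM IHk; case: k {IHk} => [|k] /=; rewrite ?exprS; ring.
Qed.
Lemma theta_qv : theta qv = qv.
Proof. by apply: seriesP => -[|[|n]]; rewrite thetaE qvE /= ?mulr0. Qed.
Lemma theta_sub k f : theta (sub k f) = k%:R * sub k (theta f).
Proof.
apply: seriesP => n; rewrite series_natME !series_opE; case: ifP; rewrite ?mulr0 // => /dvdnP[j ->].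
case: k => [|k]; first by rewrite muln0 !mul0r.
by rewrite mulnK // natrM; ring.
Qed.
Lemma theta_twist f : theta (twist f) = twist (theta f).
Proof. by apply: seriesP => n; rewrite !series_opE; ring. Qed.

Fact section_is_zmod_morphism m r : zmod_morphism (section m r).
Proof. by move=> f g; apply: seriesP => n. Qed.
HB.instance Definition _ m r :=
  GRing.isZmodMorphism.Build series series (section m r) (section_is_zmod_morphism m r).

(** * Cancellation and divisibility *)

Definition divides (m : nat) (f : series) := forall n, (m%:Z %| f n)%Z.

Arguments divides m%_N f.

Lemma dividesP m f : divides m f <-> exists g, f = m%:R * g.
Proof.
split=> [mf|[g ->] n]; last by rewrite series_natME natz dvdz_mulr.
exists (Series (fun n => (f n %/ m%:Z)%Z)); apply: seriesP => n.
by rewrite series_natME natz mulrC divzK // mf.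
Qed.

(** A series with constant term 1 is invertible, so it can be cancelled from a
divisibility, one coefficient after the other. *)
Lemma divides_cancel m (f g : series) : f 0%N = 1 -> divides m (f * g) -> divides m g.
Proof.
move=> f0 mfg n; elim/ltn_ind: n => n IHn.
have := mfg n; rewrite seriesME big_ord_recl f0 mul1r subn0 rpredDr //.
apply: rpred_sum => i _.
by rewrite dvdz_mull // IHn //= /bump; have := ltn_ord i; lia.
Qed.

Lemma series_cancel (f g h : series) : f 0%N = 1 -> f * g = f * h -> g = h.
Proof.
move=> f0 fgh; apply: subr0_eq; have: f * (g - h) = 0 by rewrite mulrBr fgh subrr.
move: (g - h) => {fgh g h} g fg; apply: seriesP => n; rewrite series0E.
elim/ltn_ind: n => n IHn.
have /(congr1 (fun h : series => h n)) := fg.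
rewrite series0E seriesME big_ord_recl f0 mul1r subn0 big1 ?addr0 // => i _.
by rewrite IHn ?mulr0 //= /bump; have := ltn_ord i; lia.
Qed.

Lemma qv_cancel (f g : series) : qv * f = qv * g -> f = g.
Proof. by move=> fg; apply: seriesP => n; rewrite -(qvMS f) fg qvMS. Qed.
Lemma nat_cancel m (f g : series) : m.+1%:R * f = m.+1%:R * g -> f = g.
Proof.
move=> fg; apply: seriesP => n; have /(congr1 (fun h : series => h n)) := fg.
by rewrite !series_natME => /(mulfI _); apply; rewrite pnatr_eq0.
Qed.

(** * Truncation *)

Definition approx N (f g : series) := forall n, (n <= N)%N -> f n = g n.

Lemma approx_eq (f g : series) : (forall N, approx N f g) -> f = g.
Proof. by move=> fg; apply: seriesP => n; apply: (fg n). Qed.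
Lemma approx_refl N f : approx N f f. Proof. by []. Qed.
Lemma approx_sym N f g : approx N f g -> approx N g f.
Proof. by move=> fg n /fg. Qed.
Lemma approx_trans N f g h : approx N f g -> approx N g h -> approx N f h.
Proof. by move=> fg gh n le_nN; rewrite fg // gh. Qed.
Lemma approx_le M N f g : (M <= N)%N -> approx N f g -> approx M f g.
Proof. by move=> le_MN fg n le_nM; apply: fg; apply: leq_trans le_MN. Qed.
Lemma approxD N (f f' g g' : series) :
  approx N f f' -> approx N g g' -> approx N (f + g) (f' + g').
Proof. by move=> ff gg n le_nN; rewrite !seriesDE ff ?gg. Qed.
Lemma approxN N (f f' : series) : approx N f f' -> approx N (- f) (- f').
Proof. by move=> ff n le_nN; rewrite !seriesNE ff. Qed.
Lemma approxM N (f f' g g' : series) :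
  approx N f f' -> approx N g g' -> approx N (f * g) (f' * g').
Proof.
move=> ff gg n le_nN; rewrite !seriesME; apply: eq_bigr => i _.
by rewrite ff ?gg //; have := ltn_ord i; lia.
Qed.
Lemma approxX N k (f f' : series) : approx N f f' -> approx N (f ^+ k) (f' ^+ k).
Proof. by move=> ff; elim: k => // k IHk; rewrite !exprS; apply: approxM. Qed.
Lemma approx_qv N k (f g : series) : (N < k)%N -> approx N (f + qv ^+ k * g) f.
Proof.
by move=> lt_Nk n le_nN; rewrite seriesDE qvXM leqNgt (leq_ltn_trans le_nN) // addr0.
Qed.
Lemma approx_sum0 N (I : Type) (r : seq I) (P : pred I) (F : I -> series) :
  (forall i, P i -> approx N (F i) 0) -> approx N (\sum_(i <- r | P i) F i) 0.
Proof.
by move=> F0; elim/big_ind: _ => // f g f0 g0; rewrite -[0]addr0; apply: approxD.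
Qed.
Lemma approx_sub m N f g : approx N f g -> approx N (sub m.+1 f) (sub m.+1 g).
Proof.
move=> fg n le_nN; rewrite !subE fg // (leq_trans _ le_nN) //; exact: leq_div.
Qed.
Lemma approx_sub2 N f g : approx N f g -> approx N.*2 (sub 2 f) (sub 2 g).
Proof. by move=> fg n le_nN; rewrite !subE fg //; lia. Qed.
Lemma approx_twist N f g : approx N f g -> approx N (twist f) (twist g).
Proof. by move=> fg n le_nN; rewrite !twistE fg. Qed.
Lemma approx_theta N f g : approx N f g -> approx N (theta f) (theta g).
Proof. by move=> fg n le_nN; rewrite !thetaE fg. Qed.
Lemma approx_divides m f :
  (forall N, exists2 g, approx N f g & divides m g) -> divides m f.
Proof. by move=> fg n; have [g -> //] := fg n. Qed.

(** The limit of a sequence whose n-th term is correct up to degree n. *)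
Definition slimit (F : nat -> series) := Series (fun n => F n n).

Lemma slimit_approx (F : nat -> series) N :
  (forall n, approx n (F n.+1) (F n)) -> approx N (slimit F) (F N).
Proof.
move=> F_stable n le_nN; rewrite -(subnKC le_nN); elim: (N - n)%N => [|d IHd].
  by rewrite addn0.
by rewrite IHd addnS F_stable // leq_addr.
Qed.

(** * Lambert series *)

Definition lambert (w : series) :=
  Series (fun n => \sum_(1 <= k < n.+1) sub k w n).

Lemma lambertE w n : lambert w n = \sum_(1 <= k < n.+1) sub k w n.
Proof. by []. Qed.

Lemma lambert_approx N (w : series) : w 0%N = 0 ->
  approx N (lambert w) (\sum_(1 <= k < N.+1) sub k w).
Proof.
move=> w0 n le_nN; rewrite series_sumE lambertE (@big_cat_nat _ _ _ n.+1 1 N.+1) //=.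
rewrite [X in _ + X]big_nat_cond [X in _ + X]big1 ?addr0 // => i.
rewrite andbT => /andP[lt_ni _]; rewrite subE; case: ifP => // /dvdnP[j def_n].
by case: j def_n => [|j] def_n; [rewrite def_n div0n | lia].
Qed.

Lemma lambert0 (w : series) : lambert w 0%N = 0.
Proof. by rewrite lambertE big_geq. Qed.

Fact lambert_is_zmod_morphism : zmod_morphism lambert.
Proof.
move=> f g; apply: seriesP => n; rewrite seriesBE !lambertE -sumrB.
by apply: eq_bigr => k _; rewrite raddfB.
Qed.
HB.instance Definition _ :=
  GRing.isZmodMorphism.Build series series lambert lambert_is_zmod_morphism.

Lemma lambert_sub m (w : series) : w 0%N = 0 -> lambert (sub m.+1 w) = sub m.+1 (lambert w).
Proof.
move=> w0; apply: approx_eq => N.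
refine (approx_trans _ (approx_sub m (approx_sym (lambert_approx w0)))).
rewrite raddf_sum (eq_bigr (fun k => sub k (sub m.+1 w))).
  by apply: lambert_approx; rewrite sub_coef0.
by move=> k _ /=; rewrite !subM mulnC.
Qed.

Lemma sum_even_nat (F : nat -> series) N :
  \sum_(1 <= k < N.*2.+1 | ~~ odd k) F k = \sum_(1 <= j < N.+1) F j.*2.
Proof.
elim: N => [|N IHN]; first by rewrite !big_geq.
rewrite [RHS]big_nat_recr //= -IHN [LHS]big_mkcond doubleS.
do 2 rewrite big_nat_recr //=.
by rewrite -big_mkcond odd_double addr0.
Qed.

(** In the sum over k of w(q^k), the sign change acts on w when k is odd and does
nothing when k is even; the even k contribute a Lambert series in q^2. *)
Lemma twist_lambert (w : series) : w 0%N = 0 ->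
  twist (lambert w) = lambert (twist w) + sub 2 (lambert (w - twist w)).
Proof.
move=> w0; apply: approx_eq => N; apply: (@approx_le N N.*2); first by lia.
have tw0 : twist w 0%N = 0 by rewrite twistE w0 mulr0.
have v0 : (w - twist w) 0%N = 0 by rewrite seriesBE w0 tw0 subr0.
refine (approx_trans (approx_twist (lambert_approx w0)) _).
refine (approx_trans _ (approxD (approx_sym (lambert_approx tw0))
  (approx_sub2 (approx_sym (lambert_approx v0))))).
move=> n _; congr (coefs _ n).
rewrite !raddf_sum /=; set v := w - twist w.
have -> : \sum_(1 <= i < N.+1) sub 2 (sub i v) =
          \sum_(1 <= i < N.*2.+1 | ~~ odd i) sub i v.
  by rewrite (sum_even_nat (sub^~ v)); apply: eq_bigr => i _; rewrite subM mul2n.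
rewrite [X in _ = _ + X]big_mkcond -big_split; apply: eq_bigr => k _ /=.
case: (boolP (odd k)) => ok /=; first by rewrite addr0 twist_sub_odd.
by rewrite twist_sub_even //= raddfB addrC subrK.
Qed.

(** Sums over divisors become sums over pairs of positive integers below any
large bound, the form in which solutions of ax + by = n are counted. *)
Lemma sub_divisor_sum M n x (w : series) : w 0%N = 0 -> (n < M)%N -> (0 < x)%N ->
  sub x w n = \sum_(a < M | [&& 0 < a, 0 < x & a * x == n]%N) w a.
Proof.
move=> w0 lt_nM x_gt0; rewrite subE; case: ifP => [xn|nxn]; last first.
  rewrite big_pred0 // => a; apply/negP => /and3P[_ _ /eqP ax].
  by rewrite -ax dvdn_mull in nxn.
have [n0|n_gt0] := posnP n.
  rewrite n0 div0n w0 big_pred0 // => a; apply/negP => /and3P[a_gt0 _ /eqP]; nia.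
have lt : (n %/ x < M)%N by apply: leq_ltn_trans (leq_div _ _) _.
rewrite (big_pred1 (Ordinal lt)) // => a; rewrite /= x_gt0 /=.
apply/andP/eqP => [[_ /eqP ax]|->]; first by apply/val_inj; rewrite /= -ax mulnK.
by rewrite /= divnK // eqxx divn_gt0 // dvdn_leq.
Qed.

Lemma lambert_pairs M n (w : series) : w 0%N = 0 -> (n < M)%N ->
  lambert w n = \sum_(x < M) \sum_(a < M | [&& 0 < a, 0 < x & a * x == n]%N) w a.
Proof.
move=> w0 lt_nM; case: M lt_nM => // M lt_nM.
rewrite (lambert_approx w0 (lt_nM : (n <= M)%N)) series_sumE.
rewrite -(big_mkord xpredT
  (fun x => \sum_(a < M.+1 | [&& 0 < a, 0 < x & a * x == n]%N) w a)).
rewrite [RHS]big_ltn // [X in X + _]big_pred0 ?add0r; last by move=> a; rewrite andbF.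
by rewrite !big_nat; apply: eq_bigr => x /andP[x_gt0 _]; apply: sub_divisor_sum.
Qed.

Definition geometric : series := Series (fun=> 1).
Lemma geometricE : (1 - qv) * geometric = 1.
Proof.
rewrite mulrBl mul1r; apply: seriesP => -[|n]; rewrite seriesBE ?qvM0 ?qvMS.
  by rewrite series1E subr0.
by rewrite series1E subrr.
Qed.

(** Only for k = 0 does the condition on n matter, since 0^0 = 1. *)
Definition powers k : series := Series (fun n => n%:R ^+ k *+ (n != 0%N)).
Arguments powers k%_N.
Lemma powersE k n : powers k n = n%:R ^+ k *+ (n != 0%N). Proof. by []. Qed.
Lemma powersS k : powers k.+1 = theta (powers k).
Proof. by apply: seriesP => n; rewrite thetaE !powersE exprS mulrnAr. Qed.

Lemma powers0_closed : (1 - qv) * powers 0 = qv.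
Proof.
have -> : powers 0 = geometric - 1.
  by apply: seriesP => -[|n]; rewrite seriesBE series1E powersE ?subr0 ?subrr.
by rewrite mulrBr geometricE; ring.
Qed.

(** The Eulerian polynomial of degree 3, from three derivations of
(1 - q) (sum of q^n) = q. *)
Lemma powers3_closed : (1 - qv) ^+ 4 * powers 3 = qv + 4 * qv ^+ 2 + qv ^+ 3.
Proof.
have H0 := powers0_closed.
have th1 : theta (1 - qv) = - qv by rewrite thetaB theta1 theta_qv sub0r.
have H1 := congr1 theta H0; rewrite thetaM th1 theta_qv -powersS in H1.
have H2 := congr1 theta H1.
rewrite !(thetaD, thetaN, thetaM, theta_qv, th1) -!powersS in H2.
have H3 := congr1 theta H2.
rewrite !(thetaD, thetaN, thetaM, theta_qv, th1) -!powersS in H3.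
have K1 : (1 - qv) ^+ 2 * powers 1 = qv.
  have -> : (1 - qv) ^+ 2 * powers 1 =
    (1 - qv) * (- qv * powers 0 + (1 - qv) * powers 1) + qv * ((1 - qv) * powers 0)
    by ring.
  by rewrite H1 H0; ring.
have K2 : (1 - qv) ^+ 3 * powers 2 = qv + qv ^+ 2.
  have -> : (1 - qv) ^+ 3 * powers 2 =
    (1 - qv) ^+ 2 * (- qv * powers 0 + - qv * powers 1 +
      (- qv * powers 1 + (1 - qv) * powers 2)) +
    qv * (1 - qv) * ((1 - qv) * powers 0) + 2 * qv * ((1 - qv) ^+ 2 * powers 1)
    by ring.
  by rewrite H2 K1 H0; ring.
move: H3; set L := (X in X = _) => H3.
have -> : (1 - qv) ^+ 4 * powers 3 =
    (1 - qv) ^+ 3 * L + qv * (1 - qv) ^+ 2 * ((1 - qv) * powers 0) +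
    3 * qv * (1 - qv) * ((1 - qv) ^+ 2 * powers 1) +
    3 * qv * ((1 - qv) ^+ 3 * powers 2).
  by rewrite /L; ring.
by rewrite H3 K2 K1 H0; ring.
Qed.

(** * Euler's product and its fifth power *)

Definition euler_poly N : series := \prod_(1 <= k < N.+1) (1 - qv ^+ k).
Definition euler := slimit euler_poly.

Lemma euler_polyS N : euler_poly N.+1 = euler_poly N * (1 - qv ^+ N.+1).
Proof. by rewrite /euler_poly big_nat_recr. Qed.

Lemma euler_approx N : approx N euler (euler_poly N).
Proof.
apply: slimit_approx => n; rewrite euler_polyS.
have -> : euler_poly n * (1 - qv ^+ n.+1) =
    euler_poly n + qv ^+ n.+1 * (- euler_poly n) by ring.
exact: approx_qv.
Qed.

Lemma euler0 : euler 0%N = 1.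
Proof. by rewrite (euler_approx (leqnn 0)) /euler_poly big_geq // series1E. Qed.

Definition sigma k := lambert (powers k).
Arguments sigma k%_N.

(** The logarithmic derivative of 1 - q^k is -k (q^k + q^(2k) + ...), and the sum
of these over k is sigma_1 summed over the complementary divisors. *)
Lemma theta_euler : theta euler = - (euler * sigma 1).
Proof.
pose T N := \sum_(1 <= k < N.+1) k%:R * sub k (powers 0).
have eT N : theta (euler_poly N) = - (euler_poly N * T N).
  elim: N => [|N IHN].
    by rewrite /euler_poly /T !big_geq // theta1 mulr0 oppr0.
  have -> : T N.+1 = T N + N.+1%:R * sub N.+1 (powers 0) by rewrite /T big_nat_recr.
  rewrite euler_polyS thetaM IHN.
  have -> : theta (1 - qv ^+ N.+1) =
      - (N.+1%:R * ((1 - qv ^+ N.+1) * sub N.+1 (powers 0))).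
    have := congr1 (sub N.+1) powers0_closed.
    rewrite !sub_morph sub_qv => ->.
    by rewrite thetaB theta1 -sub_qv theta_sub theta_qv sub0r.
  ring.
have T_sigma N : approx N (sigma 1) (T N).
  move=> n le_nN; rewrite (lambert_pairs _ (le_nN : (n < N.+1)%N)) //.
  rewrite (exchange_big_dep xpredT) //= series_sumE [RHS]big_add1 big_mkord.
  rewrite big_ord_recl big_pred0 ?add0r //.
  apply: eq_bigr => a _; rewrite series_natME.
  rewrite (@sub_divisor_sum N.+1) // mulr_sumr; apply: eq_big => x.
    by rewrite andbCA mulnC.
  by case/and3P => _ x_gt0 _; rewrite !powersE -!lt0n x_gt0 expr0 expr1 mulr1.
apply: approx_eq => N.
refine (approx_trans (approx_theta (@euler_approx N)) _); rewrite eT.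
apply/approxN/approxM; first exact/approx_sym/(@euler_approx N).
exact/approx_sym/T_sigma.
Qed.

(** Both sides are compared after multiplication by (1 - q)^4, which clears the
denominator of the sum of n^3 q^n; [p] is the difference divided by 25. *)
Lemma factor_pow5 : exists h,
  (1 - qv) ^+ 5 = (1 - qv ^+ 5) * (1 - 5 * powers 3) + 25%:R * h.
Proof.
pose p : series := 2 * qv ^+ 2 - 3 * qv ^+ 3 + 5 * qv ^+ 4 - 5 * qv ^+ 5 + 3 * qv ^+ 6 - 2 * qv ^+ 7.
have [|h h_def] := iffLR (dividesP 25 ((1 - qv) ^+ 5 - (1 - qv ^+ 5) * (1 - 5 * powers 3))).
  apply: (@divides_cancel _ ((1 - qv) ^+ 4)).
    by rewrite seriesX0 seriesBE series1E qvE subr0 expr1n.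
  apply/dividesP; exists p.
  transitivity ((1 - qv) ^+ 9 - (1 - qv ^+ 5) *
     ((1 - qv) ^+ 4 - 5 * ((1 - qv) ^+ 4 * powers 3))); first by ring.
  by rewrite powers3_closed /p; ring.
by exists h; rewrite -h_def; ring.
Qed.

(** The factors 1 - 5 (sum of n^3 q^(kn)) multiply modulo 25 to 1 - 5 times the
sum of all these series, which is the Lambert series of sigma_3. *)
Lemma euler_pow5 : exists h,
  euler ^+ 5 = sub 5 euler * (1 - 5 * sigma 3) + 25%:R * h.
Proof.
pose T N := \sum_(1 <= k < N.+1) sub k (powers 3).
have fin N : exists h, euler_poly N ^+ 5 =
    sub 5 (euler_poly N) * (1 - 5 * T N) + 25%:R * h.
  elim: N => [|N [h1 IHN]].
    by exists 0; rewrite /T /euler_poly !big_geq // rmorph1; ring.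
  have [h2 H2] := factor_pow5.
  have {H2} := congr1 (sub N.+1) H2.
  rewrite !sub_morph sub_qv; set w := sub N.+1 (powers 3); set x := qv ^+ N.+1 => H2.
  have TS : T N.+1 = T N + w by rewrite /T big_nat_recr.
  rewrite euler_polyS exprMn IHN H2 TS !sub_morph sub_qv.
  set A := sub 5 (euler_poly N); set B := T N; set h := sub N.+1 h2.
  have -> : (qv ^+ 5) ^+ N.+1 = x ^+ 5 :> series by rewrite /x -!exprM mulnC.
  exists (A * (1 - x ^+ 5) * B * w + h1 * (1 - x ^+ 5) * (1 - 5 * w)
    + A * (1 - 5 * B) * h + 25 * h1 * h).
  ring.
have [|h h_def] := iffLR (dividesP 25 (euler ^+ 5 - sub 5 euler * (1 - 5 * sigma 3))).
  apply: approx_divides => N.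
  exists (euler_poly N ^+ 5 - sub 5 (euler_poly N) * (1 - 5 * T N)); last first.
    by apply/dividesP; have [h ->] := fin N; exists h; rewrite addrC addKr.
  have fN := @euler_approx N.
  apply: approxD; first exact: approxX.
  apply/approxN/approxM; first exact: approx_sub.
  apply/approxD => //; apply/approxN/approxM => //.
  exact: lambert_approx.
by exists h; rewrite -h_def; ring.
Qed.

(** * Liouville's identity for ax + by = n *)

Lemma big_partial_bij (I J : finType) (P : pred I) (Q : pred J)
    (f : I -> J) (g : J -> I) (F : I -> int) (G : J -> int) :
    (forall i, P i -> [/\ Q (f i), g (f i) = i & F i = G (f i)]) ->
    (forall j, Q j -> P (g j) /\ f (g j) = j) ->
  \sum_(i | P i) F i = \sum_(j | Q j) G j.
Proof.
move=> fP gP; rewrite (reindex_onto f g) => [|j /gP[]//].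
apply: eq_big => [i|i /fP[]//].
apply/idP/andP => [/fP[-> -> _]|[/gP[Pg _] /eqP <-]] //.
Qed.

Section Quadruples.
Variable n : nat.

(* A quadruple of positive integers a, b, x, y with ax + by = n is kept as
   ((a, b), (x, y)). *)
Let quad : finType := (('I_n.+1 * 'I_n.+1) * ('I_n.+1 * 'I_n.+1))%type.
Let isq (t : quad) : bool :=
  [&& 0 < t.1.1, 0 < t.1.2, 0 < t.2.1, 0 < t.2.2 &
      t.1.1 * t.2.1 + t.1.2 * t.2.2 == n]%N.

Definition quad_sum (c : nat -> nat -> nat -> nat -> bool)
    (h : nat -> nat -> nat -> nat -> int) : int :=
  \sum_(t : quad | isq t && c t.1.1 t.1.2 t.2.1 t.2.2)
     h t.1.1 t.1.2 t.2.1 t.2.2.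

(** The shear with ax + by = a(x - y) + (a + b)y is a bijection from the solutions
with y < x onto those with a < b. *)
Lemma quad_sum_shear h :
  quad_sum (fun a b x y => (y < x)%N) (fun a b x y => h a (a + b)%N (x - y)%N y) =
  quad_sum (fun a b x y => (a < b)%N) h.
Proof.
apply: (@big_partial_bij _ _ _ _
  (fun t : quad => ((t.1.1, inord (t.1.1 + t.1.2)), (inord (t.2.1 - t.2.2), t.2.2)) : quad)
  (fun t : quad => ((t.1.1, inord (t.1.2 - t.1.1)), (inord (t.2.1 + t.2.2), t.2.2)) : quad)).
  move=> [[a b] [x y]] /=; rewrite /isq /= => /andP[/and5P[a0 b0 x0 y0 /eqP e] yx].
  have ab : (a + b < n.+1)%N by nia.
  have xy : (x - y < n.+1)%N by have := ltn_ord x; lia.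
  rewrite !inordK // addKn (subnK (ltnW yx)) !inord_val; split=> //.
  have e' : (a * (x - y) + (a + b) * y == n)%N.
    by apply/eqP; rewrite mulnDl addnA -mulnDr subnK ?(ltnW yx).
  by rewrite a0 y0 subn_gt0 yx addn_gt0 a0 e' /=; lia.
move=> [[a b] [x y]] /=; rewrite /isq /= => /andP[/and5P[a0 b0 x0 y0 /eqP e] ab].
have ba : (b - a < n.+1)%N by have := ltn_ord b; lia.
have xy : (x + y < n.+1)%N by nia.
rewrite !inordK // (subnKC (ltnW ab)) addnK !inord_val; split=> //.
have e' : (a * (x + y) + (b - a) * y == n)%N.
  by apply/eqP; rewrite mulnDr -addnA -mulnDl subnKC ?(ltnW ab).
by rewrite a0 y0 subn_gt0 ab addn_gt0 x0 e' /=; lia.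
Qed.

Lemma quad_sum_swap c h :
  quad_sum c h = quad_sum (fun a b x y => c b a y x) (fun a b x y => h b a y x).
Proof.
pose f (t : quad) : quad := ((t.1.2, t.1.1), (t.2.2, t.2.1)).
have fK : involutive f by move=> [[a b] [x y]].
apply: (@big_partial_bij _ _ _ _ f f) => t; rewrite fK => /andP[q ct]; split=> //;
  rewrite ct andbT; case/and5P: q => a0 b0 x0 y0 e;
  by rewrite /isq /= a0 b0 x0 y0 addnC.
Qed.

Lemma quad_sum_transpose c h :
  quad_sum c h = quad_sum (fun a b x y => c x y a b) (fun a b x y => h x y a b).
Proof.
pose f (t : quad) : quad := (t.2, t.1).
have fK : involutive f by move=> [[a b] [x y]].
apply: (@big_partial_bij _ _ _ _ f f) => t; rewrite fK => /andP[q ct]; split=> //;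
  rewrite ct andbT; case/and5P: q => a0 b0 x0 y0 e;
  by rewrite /isq /= a0 b0 x0 y0 mulnC (mulnC t.2.2).
Qed.

Lemma quad_sum_trichotomy (u v : nat -> nat -> nat -> nat -> nat) h :
  quad_sum (fun a b x y => true) h =
    quad_sum (fun a b x y => (u a b x y < v a b x y)%N) h +
    quad_sum (fun a b x y => (v a b x y < u a b x y)%N) h +
    quad_sum (fun a b x y => u a b x y == v a b x y) h.
Proof.
rewrite /quad_sum (bigID (fun t : quad => (u t.1.1 t.1.2 t.2.1 t.2.2 < v t.1.1 t.1.2 t.2.1 t.2.2)%N)) /=.
rewrite -addrA; congr (_ + _).
  by apply: eq_bigl => t; rewrite andbT.
rewrite (bigID (fun t : quad => (v t.1.1 t.1.2 t.2.1 t.2.2 < u t.1.1 t.1.2 t.2.1 t.2.2)%N)) /=.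
by congr (_ + _); apply: eq_bigl => t; rewrite andbT -andbA; case: (isq t) => //=; lia.
Qed.

Lemma eq_quad_sum (c c' : nat -> nat -> nat -> nat -> bool)
    (h h' : nat -> nat -> nat -> nat -> int) :
    (forall a b x y, c a b x y = c' a b x y) ->
    (forall a b x y, (0 < a)%N -> (0 < b)%N -> c a b x y -> h a b x y = h' a b x y) ->
  quad_sum c h = quad_sum c' h'.
Proof.
move=> cc hh; apply: eq_big => [t|t /andP[/and5P[a0 b0 _ _ _] ct]]; first by rewrite cc.
exact: hh.
Qed.

Lemma quad_sumB c h h' :
  quad_sum c (fun a b x y => h a b x y - h' a b x y) = quad_sum c h - quad_sum c h'.
Proof. exact: sumrB. Qed.

(** Even functions of a - b are represented as functions of the distance. *)
Definition dist a b := ((a - b) + (b - a))%N.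

(** Each full sum is split by the sign of x - y or of a - b, and the shear carries
the pieces of one into pieces of the other; only the diagonals a = b and x = y
survive. *)
Lemma liouville (f : nat -> int) :
  quad_sum (fun a b x y => true) (fun a b x y => f (dist a b) - f (a + b)%N) =
    2 * (quad_sum (fun a b x y => a == b) (fun a b x y => f b) -
         quad_sum (fun a b x y => x == y) (fun a b x y => f b))
    + quad_sum (fun a b x y => a == b) (fun a b x y => f 0%N)
    - quad_sum (fun a b x y => x == y) (fun a b x y => f (a + b)%N).
Proof.
rewrite quad_sumB.
have tri1 := quad_sum_trichotomy (fun a b x y => y) (fun a b x y => x)
  (fun a b x y => f (a + b)%N).
have tri2 := quad_sum_trichotomy (fun a b x y => a) (fun a b x y => b)
  (fun a b x y => f (dist a b)).
have tri3 := quad_sum_trichotomy (fun a b x y => y) (fun a b x y => x)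
  (fun a b x y => f b).
have tri4 := quad_sum_trichotomy (fun a b x y => a) (fun a b x y => b)
  (fun a b x y => f b).
have s1 := quad_sum_shear (fun a b x y => f b).
have s2 := quad_sum_shear (fun a b x y => f (dist a b)).
have s3 := quad_sum_shear (fun a b x y => f a).
have e1 : quad_sum (fun a b x y => (x < y)%N) (fun a b x y => f (a + b)%N) =
          quad_sum (fun a b x y => (y < x)%N) (fun a b x y => f (a + b)%N).
  by rewrite quad_sum_swap; apply: eq_quad_sum => // a b *; rewrite addnC.
have e2 : quad_sum (fun a b x y => (b < a)%N) (fun a b x y => f (dist a b)) =
          quad_sum (fun a b x y => (a < b)%N) (fun a b x y => f (dist a b)).
  by rewrite quad_sum_swap; apply: eq_quad_sum => // a b *; rewrite /dist addnC.
have e3 : quad_sum (fun a b x y => (x < y)%N) (fun a b x y => f b) =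
          quad_sum (fun a b x y => (a < b)%N) (fun a b x y => f a).
  by rewrite quad_sum_swap -s3; apply: eq_quad_sum.
have e4 : quad_sum (fun a b x y => (b < a)%N) (fun a b x y => f b) =
          quad_sum (fun a b x y => (a < b)%N) (fun a b x y => f a).
  by rewrite quad_sum_swap; apply: eq_quad_sum.
have e5 : quad_sum (fun a b x y => (y < x)%N) (fun a b x y => f b) =
          quad_sum (fun a b x y => (a < b)%N) (fun a b x y => f (dist a b)).
  by rewrite -s2; apply: eq_quad_sum => // a b *; rewrite /dist; congr f; lia.
have e6 : quad_sum (fun a b x y => a == b) (fun a b x y => f (dist a b)) =
          quad_sum (fun a b x y => a == b) (fun a b x y => f 0%N).
  by apply: eq_quad_sum => // a b x y _ _ /eqP->; rewrite /dist subnn.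
have e7 : quad_sum (fun a b x y => y == x) (fun a b x y => f b) =
          quad_sum (fun a b x y => x == y) (fun a b x y => f b).
  by apply: eq_quad_sum => // *; rewrite eq_sym.
have e8 : quad_sum (fun a b x y => y == x) (fun a b x y => f (a + b)%N) =
          quad_sum (fun a b x y => x == y) (fun a b x y => f (a + b)%N).
  by apply: eq_quad_sum => // *; rewrite eq_sym.
rewrite /= in tri1 tri2 tri3 tri4 s1.
lra.
Qed.
End Quadruples.

Lemma quad_sum_product n (w v : series) : w 0%N = 0 -> v 0%N = 0 ->
  quad_sum n (fun a b x y => true) (fun a b x y => w a * v b) =
    (lambert w * lambert v) n.
Proof.
move=> w0 v0; rewrite seriesME /quad_sum.
rewrite (partition_big
  (fun t : 'I_n.+1 * 'I_n.+1 * ('I_n.+1 * 'I_n.+1) =>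
     inord (t.1.1 * t.2.1) : 'I_n.+1) xpredT) //=.
apply: eq_bigr => i _.
rewrite (lambert_pairs w0 (ltn_ord i)) (lambert_pairs v0 (_ : n - i < n.+1)%N); last by lia.
rewrite !pair_big_dep /= big_distrlr pair_big_dep /=.
apply: (@big_partial_bij _ _ _ _ (fun t => ((t.2.1, t.1.1), (t.2.2, t.1.2)))
  (fun t => ((t.1.2, t.2.2), (t.1.1, t.2.1)))).
  move=> [[a b] [x y]] /=; rewrite andbT => /andP[/and5P[a0 b0 x0 y0 /eqP e] /eqP <-].
  have ax : (a * x < n.+1)%N by rewrite ltnS -[X in (_ <= X)%N]e leq_addr.
  by split=> //; rewrite a0 b0 x0 y0 inordK ?eqxx //=; apply/eqP; lia.
move=> [[x a] [y b]] /=; rewrite andbT => /andP[/and3P[a0 x0 /eqP ax] /and3P[b0 y0 /eqP by_]].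
rewrite a0 b0 x0 y0 ax by_ inord_val eqxx andbT; split=> //=.
by apply/eqP; have := ltn_ord i; lia.
Qed.

Lemma quad_sum_diagonal n (h : nat -> nat -> nat -> int) :
  quad_sum n (fun a b x y => x == y) (fun a b x y => h a b x) =
  \sum_(x < n.+1) \sum_(c < n.+1 | [&& 0 < c, 0 < x & c * x == n]%N)
    \sum_(1 <= b < c) h (c - b)%N b x.
Proof.
transitivity (\sum_(x < n.+1) \sum_(c < n.+1 | [&& 0 < c, 0 < x & c * x == n]%N)
    \sum_(b < n.+1 | ((b < c) && (0 < b))%N) h (c - b)%N b x); last first.
  apply: eq_bigr => x _; apply: eq_bigr => c _.
  rewrite (big_nat_widen _ _ n.+1) 1?ltnW // big_geq_mkord /=.
  by apply: eq_bigl => b; rewrite andbC.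
rewrite !pair_big_dep /quad_sum /=.
apply: (@big_partial_bij _ _ _ _
  (fun t : 'I_n.+1 * 'I_n.+1 * ('I_n.+1 * 'I_n.+1) =>
     ((t.2.1, inord (t.1.1 + t.1.2) : 'I_n.+1), t.1.2))
  (fun t : 'I_n.+1 * 'I_n.+1 * 'I_n.+1 =>
     ((inord (t.1.2 - t.2) : 'I_n.+1, t.2), (t.1.1, t.1.1)))).
  move=> [[a b] [x y]] /= /andP[/and5P[a0 b0 x0 y0 /eqP e] /eqP /val_inj xy].
  rewrite -xy in y0 e *.
  have ab : (a + b < n.+1)%N by nia.
  rewrite !inordK // addnK !inord_val; split=> //.
  by rewrite addn_gt0 a0 x0 b0 mulnDl e eqxx /= andbT; lia.
move=> [[x c] b] /= /andP[/and3P[c0 x0 /eqP e] /andP[bc b0]].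
have cb : (c - b < n.+1)%N by have := ltn_ord c; lia.
rewrite !inordK // (subnK (ltnW bc)) !inord_val; split=> //.
rewrite subn_gt0 bc b0 x0 eqxx andbT -mulnDl (subnK (ltnW bc)) /=.
exact/eqP.
Qed.

Lemma lambert_cofactor n (w : series) : w 0%N = 0 ->
  lambert w n =
  \sum_(x < n.+1) \sum_(c < n.+1 | [&& 0 < c, 0 < x & c * x == n]%N) w x.
Proof.
move=> w0; rewrite (lambert_pairs w0 (ltnSn n)) (exchange_big_dep xpredT) //=.
by apply: eq_bigr => x _; apply: eq_bigl => c; rewrite andbCA mulnC.
Qed.

(** * Squares of Lambert series *)

Definition signed_powers (e : int) k : series :=
  Series (fun n => e ^+ n * n%:R ^+ k *+ (n != 0%N)).
Definition signed_square_sums (e : int) : series :=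
  Series (fun n => \sum_(1 <= b < n) e ^+ b * b%:R ^+ 2).

Arguments signed_powers e k%_N.

Lemma signed_powersE e k n :
  signed_powers e k n = e ^+ n * n%:R ^+ k *+ (n != 0%N).
Proof. by []. Qed.

(** [liouville] for f(k) = e^k k^2 with e = 1 or -1: since e^(a-b) = e^(a+b), the
left side is -4 times the product of e^a a and e^b b. *)
Lemma lambert_square (e : int) : e * e = 1 ->
  let w k := signed_powers e k in
  4 * lambert (w 1%N) ^+ 2 =
    - (2 * theta (lambert (w 1%N))) + 2 * lambert (w 2%N)
    + 2 * lambert (signed_square_sums e) + lambert (w 3%N - w 2%N).
Proof.
move=> ee w; apply: seriesP => n.
have w0 k : w k 0%N = 0 by [].
pose f k := e ^+ k * k%:R ^+ 2.
have L := liouville n f.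
have ea a : e ^+ a * e ^+ a = 1 by rewrite -exprMn ee expr1n.
have fD a d : f d - f (a + (a + d))%N =
    - (4 * (e ^+ a * a%:R * (e ^+ (a + d) * (a + d)%:R))).
  by rewrite -[f d]mul1r -[X in X * f d](ea a) /f !natrD !exprD; ring.
have fE a b : f (dist a b) - f (a + b)%N = - (4 * (e ^+ a * a%:R * (e ^+ b * b%:R))).
  case: (leqP a b) => [ab|/ltnW ba].
    by have := fD a (b - a)%N; rewrite subnKC // /dist (eqP (ab : (a - b == 0)%N)) add0n.
  have := fD b (a - b)%N; rewrite subnKC // /dist (eqP (ba : (b - a == 0)%N)) addn0.
  by rewrite addnC => ->; ring.
have w1E a : (0 < a)%N -> w 1%N a = e ^+ a * a%:R.
  by move=> a0; rewrite signed_powersE -lt0n a0 expr1.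
have L1 : quad_sum n (fun a b x y => true) (fun a b x y => f (dist a b) - f (a + b)%N) =
    - (4 * (lambert (w 1%N) ^+ 2) n).
  rewrite expr2 -quad_sum_product // /quad_sum mulr_sumr -sumrN.
  by apply: eq_bigr => t /andP[/and5P[a0 b0 _ _ _] _]; rewrite fE !w1E.
have L2 : quad_sum n (fun a b x y => a == b) (fun a b x y => f b) =
    (theta (lambert (w 1%N)) - lambert (w 2%N)) n.
  transitivity (quad_sum n (fun a b x y => x == y) (fun a b x y => f x)).
    by rewrite quad_sum_transpose; apply: eq_quad_sum => // a b x y _ _ /eqP ->.
  rewrite (quad_sum_diagonal n (fun _ _ x => f x)).
  rewrite seriesBE thetaE !lambert_cofactor // mulr_sumr -sumrB.
  apply: eq_bigr => x _; rewrite mulr_sumr -sumrB.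
  apply: eq_bigr => c /and3P[c0 x0 /eqP cx].
  rewrite big_const_nat iter_addr_0 !signed_powersE -lt0n x0 -[f x *+ _]mulr_natr /f.
  have -> : n%:R = c%:R * x%:R :> int by rewrite -natrM cx.
  rewrite natrB // !mulr1n; ring.
have L3 : quad_sum n (fun a b x y => x == y) (fun a b x y => f b) =
    lambert (signed_square_sums e) n.
  rewrite (quad_sum_diagonal n (fun _ b _ => f b)).
  by rewrite (lambert_pairs _ (ltnSn n)) // /signed_square_sums /coefs big_geq.
have L4 : quad_sum n (fun a b x y => a == b) (fun a b x y => f 0%N) = 0.
  by rewrite /quad_sum big1 // => t _; rewrite /f mulr0.
have L5 : quad_sum n (fun a b x y => x == y) (fun a b x y => f (a + b)%N) =
    lambert (w 3%N - w 2%N) n.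
  rewrite (quad_sum_diagonal n (fun a b _ => f (a + b)%N)) (lambert_pairs _ (ltnSn n)) //.
  apply: eq_bigr => x _; apply: eq_bigr => c /and3P[c0 x0 /eqP cx].
  rewrite (eq_big_nat _ _ (F2 := fun=> f c)) => [|b /andP[_ bc]]; last by rewrite subnK // ltnW.
  rewrite big_const_nat iter_addr_0 seriesBE !signed_powersE -lt0n c0 -[f c *+ _]mulr_natr /f.
  rewrite natrB // !mulr1n; ring.
rewrite L1 L2 L3 L4 L5 in L.
have n2 (g : series) : (2 * g) n = 2 * g n by rewrite series_natME.
have n4 (g : series) : (4 * g) n = 4 * g n by rewrite series_natME.
rewrite !(seriesDE, seriesNE, n2, n4).
rewrite !(seriesDE, seriesNE) in L; lra.
Qed.

Lemma powers_signed k : powers k = signed_powers 1 k.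
Proof. by apply: seriesP => n; rewrite powersE signed_powersE expr1n mul1r. Qed.
Lemma twist_powers_signed k : twist (powers k) = signed_powers (-1) k.
Proof. by apply: seriesP => n; rewrite twistE powersE signed_powersE mulrnAr. Qed.

Lemma lambertD f g : lambert (f + g) = lambert f + lambert g. Proof. exact: raddfD. Qed.
Lemma lambertB f g : lambert (f - g) = lambert f - lambert g. Proof. exact: raddfB. Qed.
Lemma lambertN f : lambert (- f) = - lambert f. Proof. exact: raddfN. Qed.
Lemma lambert_nat m f : lambert (m%:R * f) = m%:R * lambert f.
Proof. by rewrite !mulr_natl raddfMn. Qed.

(** Ramanujan's differential equation for the Eisenstein series of weight 2. *)
Lemma sigma_square : 12 * sigma 1 ^+ 2 = sigma 1 + 5 * sigma 3 - 6 * theta (sigma 1).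
Proof.
have /= := @lambert_square 1 (mulr1 1); rewrite -!powers_signed => L.
have V : 6 * signed_square_sums 1 = 2 * powers 3 - 3 * powers 2 + powers 1.
  apply: seriesP => n; rewrite !(seriesDE, seriesNE, series_natME) !powersE.
  rewrite /signed_square_sums /coefs.
  case: n => [|n]; first by rewrite big_geq.
  elim: n => [|n IHn]; first by rewrite big_geq.
  rewrite big_nat_recr //= mulrDr IHn expr1n mul1r /= -[n.+2%:R]natr1.
  rewrite -[n.+1%:R]natr1; ring.
have := congr1 lambert V; rewrite !(lambertD, lambertN, lambert_nat) -!/(sigma _) => LV.
move: L; rewrite lambertB -!/(sigma _) => L.
have -> : 12 * sigma 1 ^+ 2 = 3 * (4 * sigma 1 ^+ 2) by ring.
rewrite L; set v := lambert _ in LV *.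
have -> : 3 * (- (2 * theta (sigma 1)) + 2 * sigma 2 + 2 * v + (sigma 3 - sigma 2)) =
  - 6 * theta (sigma 1) + 3 * sigma 2 + 6 * v + 3 * sigma 3 by ring.
rewrite LV; ring.
Qed.

(** The companion of [sigma_square] at level 2; the sums of squares of divisors
cancel in both. *)
Lemma twisted_sigma_square :
  let t k := lambert (twist (powers k)) in
  4 * t 1%N ^+ 2 = t 1%N + t 3%N - 2 * theta (t 1%N).
Proof.
have /= := @lambert_square (-1) (mulrNN 1 1); rewrite -!twist_powers_signed => L.
have V : 2 * signed_square_sums (-1) = twist (powers 1) - twist (powers 2).
  apply: seriesP => n; rewrite !(seriesDE, seriesNE, series_natME, twistE) !powersE.
  rewrite /signed_square_sums /coefs.
  case: n => [|n]; first by rewrite big_geq.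
  elim: n => [|n IHn]; first by rewrite big_geq.
  rewrite big_nat_recr //= mulrDr IHn /= -[n.+2%:R]natr1 !exprS.
  rewrite -[n.+1%:R]natr1; ring.
have := congr1 lambert V; rewrite !(lambertD, lambertN, lambert_nat) => LV.
by rewrite L lambertB LV; ring.
Qed.

(** * The theta series phi and psi *)

Definition phi_poly N : series := 1 + 2 * \sum_(1 <= s < N.+1) qv ^+ (s ^ 2).
Definition phi := slimit phi_poly.
Definition psi_poly N : series := \sum_(0 <= s < N.+1) qv ^+ 'C(s.+1, 2).
Definition psi := slimit psi_poly.

Lemma triS s : 'C(s.+2, 2) = ('C(s.+1, 2) + s.+1)%N.
Proof. by rewrite binS bin1. Qed.
Lemma tri2 s : ('C(s.+1, 2) * 2 = s * s.+1)%N.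
Proof. by elim: s => // s IHs; rewrite triS mulnDl IHs; lia. Qed.

Lemma phi_approx N : approx N phi (phi_poly N).
Proof.
apply: slimit_approx => n; rewrite /phi_poly big_nat_recr //= mulrDr addrA mulrC.
by rewrite [X in _ + X]mulrC mulrC; apply: approx_qv; nia.
Qed.
Lemma psi_approx N : approx N psi (psi_poly N).
Proof.
apply: slimit_approx => n; rewrite /psi_poly big_nat_recr //= -[qv ^+ _]mulr1.
by apply: approx_qv; have := tri2 n.+1; nia.
Qed.

Lemma psi0 : psi 0%N = 1.
Proof. by rewrite (psi_approx (leqnn 0)) /psi_poly big_nat1. Qed.

Lemma twist_phi_poly N :
  twist (phi_poly N) = 1 + 2 * \sum_(1 <= s < N.+1) (-1) ^+ s * qv ^+ (s ^ 2).
Proof.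
rewrite /phi_poly !twist_morph; congr (_ + _ * _); rewrite raddf_sum.
apply: eq_bigr => s _ /=; rewrite twist_exp twist_qv [LHS]exprNn.
by rewrite -[(-1) ^+ (s ^ 2)]signr_odd -[(-1) ^+ s]signr_odd oddX.
Qed.

(** Even squares are 4 times squares; odd squares are 1 plus 8 times a triangular
number. *)
Lemma phi_dissection : phi = sub 4 phi + 2 * qv * sub 8 psi.
Proof.
apply: approx_eq => N; apply: (@approx_le N N.*2.+1); first by lia.
refine (approx_trans (@phi_approx N.*2.+1) _).
have aphi : approx N.*2.+1 (sub 4 phi) (sub 4 (phi_poly N)).
  by move=> n le_n; rewrite !subE (phi_approx (N := N)) //; lia.
have apsi : approx N.*2.+1 (sub 8 psi) (sub 8 (psi_poly N)).
  by move=> n le_n; rewrite !subE (psi_approx (N := N)) //; lia.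
refine (approx_trans _ (approxD (approx_sym aphi) (approxM (@approx_refl _ _) (approx_sym apsi)))).
move=> n _; congr (coefs _ n); elim: N {aphi apsi n} => [|N IHN].
  by rewrite double0 /phi_poly /psi_poly !big_nat1 big_geq // !sub_morph; ring.
have phiS M : phi_poly M.+1 = phi_poly M + 2 * qv ^+ (M.+1 ^ 2).
  by rewrite /phi_poly big_nat_recr //= mulrDr addrA.
have psiS M : psi_poly M.+1 = psi_poly M + qv ^+ 'C(M.+2, 2).
  by rewrite /psi_poly big_nat_recr.
rewrite doubleS (phiS N.*2.+2) (phiS N.*2.+1) (phiS N) psiS IHN !sub_morph !sub_qv -!exprM.
have -> : (N.*2.+3 ^ 2 = (8 * 'C(N.+2, 2)).+1)%N by have := tri2 N.+1; nia.
have -> : (N.*2.+2 ^ 2 = 4 * N.+1 ^ 2)%N by nia.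
by rewrite exprS; ring.
Qed.

(** * Gauss's square identity and Euler's pentagonal identity *)

Definition tail_poly s n : series := \prod_(s.+1 <= k < n.+1) (1 - qv ^+ k).
Definition plus_poly n : series := \prod_(1 <= k < n.+1) (1 + qv ^+ k).

Lemma tail_poly0 n : tail_poly 0 n = euler_poly n. Proof. by []. Qed.
Lemma tail_polynn n : tail_poly n n = 1.
Proof. by rewrite /tail_poly big_geq. Qed.
Lemma tail_polyS s n : (s <= n)%N -> tail_poly s n.+1 = tail_poly s n * (1 - qv ^+ n.+1).
Proof. by move=> le_sn; rewrite /tail_poly big_nat_recr. Qed.
Lemma tail_poly_pred s n : (s < n)%N -> tail_poly s n = (1 - qv ^+ s.+1) * tail_poly s.+1 n.
Proof. by move=> lt_sn; rewrite /tail_poly big_ltn. Qed.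
Lemma plus_polyS n : plus_poly n.+1 = plus_poly n * (1 + qv ^+ n.+1).
Proof. by rewrite /plus_poly big_nat_recr. Qed.

(** A finite form of Gauss's identity, in the manner of Shanks: all terms of the
sum on the right have order greater than n, so only the Euler product is left in
the limit. *)
Lemma gauss_finite n : plus_poly n * twist (phi_poly n) =
  euler_poly n + 2 * \sum_(1 <= s < n.+1)
    (-1) ^+ s * qv ^+ (s * n.+1) * plus_poly s.-1 * tail_poly s n.
Proof.
elim: n => [|n IHn].
  by rewrite twist_phi_poly /plus_poly /euler_poly !big_geq //; ring.
have phiS : twist (phi_poly n.+1) =
    twist (phi_poly n) + 2 * ((-1) ^+ n.+1 * qv ^+ (n.+1 ^ 2)).
  by rewrite !twist_phi_poly big_nat_recr //= mulrDr addrA.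
pose tau s := (-1) ^+ s * (qv ^+ (s * n.+1) * plus_poly s.-1 * tail_poly s.-1 n).
(* The difference of the sums for n and n + 1 telescopes. *)
have tele : \sum_(1 <= s < n.+1) (tau s - tau s.+1) = tau 1%N - tau n.+1.
  by rewrite -opprB -(telescope_sumr _ (ltn0Sn n)) -sumrN;
     apply: eq_bigr => s _; rewrite opprB.
have step : \sum_(1 <= s < n.+1) (tau s - tau s.+1) =
    (1 + qv ^+ n.+1) * (\sum_(1 <= s < n.+1)
      (-1) ^+ s * qv ^+ (s * n.+1) * plus_poly s.-1 * tail_poly s n)
    - \sum_(1 <= s < n.+1)
      (-1) ^+ s * qv ^+ (s * n.+2) * plus_poly s.-1 * tail_poly s n.+1.
  rewrite mulr_sumr -sumrB; apply: eq_big_nat => -[//|s] /andP[_ lt_sn'].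
  have lt_sn : (s < n)%N := lt_sn'.
  rewrite /tau /= (tail_polyS lt_sn) (tail_poly_pred lt_sn) plus_polyS.
  by rewrite !mulSn (mulnS s n.+1) !exprD !exprS; ring.
rewrite tele in step.
rewrite [in RHS]big_nat_recr //= euler_polyS plus_polyS phiS.
have -> : plus_poly n * (1 + qv ^+ n.+1) *
    (twist (phi_poly n) + 2 * ((-1) ^+ n.+1 * qv ^+ (n.+1 ^ 2))) =
    (1 + qv ^+ n.+1) * (plus_poly n * twist (phi_poly n)) +
    2 * (-1) ^+ n.+1 * qv ^+ (n.+1 ^ 2) * plus_poly n * (1 + qv ^+ n.+1) by ring.
rewrite IHn; move: step; set X := \sum_(1 <= s < n.+1) _; set Y := \sum_(1 <= s < n.+1) _ => step.
have -> : Y = (1 + qv ^+ n.+1) * X - (tau 1%N - tau n.+1) by rewrite step; ring.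
rewrite /tau /= tail_poly0 tail_polynn tail_polynn.
have -> : plus_poly 0 = 1 by rewrite /plus_poly big_geq.
rewrite mul1n (mulnS n.+1 n.+1) exprD -mulnn expr1; ring.
Qed.

Lemma plus_euler_poly n : plus_poly n * euler_poly n = sub 2 (euler_poly n).
Proof.
elim: n => [|n IHn]; first by rewrite /plus_poly /euler_poly !big_geq // sub_one mul1r.
by rewrite plus_polyS euler_polyS !sub_morph sub_qv -IHn -exprM mulnC exprM; ring.
Qed.

Lemma gauss_phi : twist phi * sub 2 euler = euler ^+ 2.
Proof.
apply: approx_eq => N.
have ae := @euler_approx N.
refine (approx_trans (approxM (approx_twist (@phi_approx N)) (approx_sub 1 ae)) _).
rewrite -plus_euler_poly mulrA [_ * plus_poly N]mulrC gauss_finite expr2.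
refine (approxM _ (approx_sym ae)); refine (approx_trans _ (approx_sym ae)).
rewrite -[X in approx _ _ X]addr0; apply: approxD => //.
rewrite -[X in approx _ _ X](mulr0 2); apply: approxM => //; rewrite big_nat_cond.
refine (@approx_sum0 N _ _ _ _ _) => s; rewrite andbT => /andP[s_gt0 _].
have -> : (-1) ^+ s * qv ^+ (s * N.+1) * plus_poly s.-1 * tail_poly s N =
  0 + qv ^+ (s * N.+1) * ((-1) ^+ s * plus_poly s.-1 * tail_poly s N) by ring.
by apply: approx_qv; nia.
Qed.

Definition pentagonal_poly n : series :=
  1 + \sum_(1 <= s < n.+1)
    (-1) ^+ s * (qv ^+ (s * s.-1 + 'C(s.+1, 2)) + qv ^+ (s * s + 'C(s.+1, 2))).

(** Shanks's finite form of the pentagonal number theorem: on the left, only the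
term s = 0 has order at most n. *)
Lemma pentagonal_finite n : \sum_(0 <= s < n.+1)
    (-1) ^+ s * tail_poly s n * qv ^+ (s * n + 'C(s.+1, 2)) = pentagonal_poly n.
Proof.
elim: n => [|n IHn].
  by rewrite big_nat1 /pentagonal_poly big_geq // tail_polynn; ring.
pose tau s := if s is s'.+1 then tail_poly s' n * qv ^+ (s * n + 'C(s.+1, 2)) else 0.
have tele : \sum_(0 <= s < n.+1) ((-1) ^+ s.+1 * tau s.+1 - (-1) ^+ s * tau s) =
    (-1) ^+ n.+1 * tau n.+1.
  by rewrite telescope_sumr // mulr0 subr0.
have -> : pentagonal_poly n.+1 = pentagonal_poly n + (-1) ^+ n.+1 *
   (qv ^+ (n.+1 * n + 'C(n.+2, 2)) + qv ^+ (n.+1 * n.+1 + 'C(n.+2, 2))).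
  by rewrite /pentagonal_poly big_nat_recr //= addrA.
rewrite big_nat_recr //= tail_polynn -IHn mulrDr addrA mulr1; congr (_ + _).
have -> : (-1) ^+ n.+1 * qv ^+ (n.+1 * n + 'C(n.+2, 2)) = (-1) ^+ n.+1 * tau n.+1.
  by rewrite /tau tail_polynn mul1r.
rewrite -tele -big_split; apply: eq_big_nat => -[_|s /andP[_ lt_sn']].
  by rewrite /tau /= !tail_poly0 euler_polyS mul0n mul1n binn addn1 bin_small // !exprS; ring.
have lt_sn : (s < n)%N := lt_sn'.
rewrite /tau /= (tail_polyS lt_sn) (tail_poly_pred lt_sn) (triS s.+1).
by rewrite !mulSn !mulnS !exprD !exprS; ring.
Qed.

(** The pentagonal numbers s(3s - 1)/2 and s(3s + 1)/2 are 0, 1 or 2 modulo 5. *)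
Lemma pentagonal_coef n : (n %% 5 = 3)%N \/ (n %% 5 = 4)%N -> euler n = 0.
Proof.
move=> n5; rewrite (euler_approx (leqnn n)).
have -> : euler_poly n n = pentagonal_poly n n.
  rewrite -pentagonal_finite big_ltn // expr0 mul1r mul0n bin_small // expr0 mulr1.
  rewrite tail_poly0 seriesDE big_nat_cond -[LHS]addr0; congr (_ + _).
  symmetry; rewrite series_sumE big1 // => s; rewrite andbT => /andP[s_gt0 _].
  rewrite mulrC qvXM leqNgt; case: ltnP => // le; have := tri2 s; nia.
rewrite seriesDE series1E series_sumE big_nat_cond big1 ?addr0.
  by move: n5; case: n => // -[].
move=> s; rewrite andbT => /andP[s_gt0 _].
have t2 := tri2 s; case: s s_gt0 t2 => // s _ t2.
have ne1 : n <> (s.+1 * s + 'C(s.+2, 2))%N.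
  move=> e; have {t2}: (2 * n = s.+1 * s * 2 + s.+1 * s.+2)%N by nia.
  rewrite (divn_eq n 5) (divn_eq s 5); have := ltn_pmod s (isT : 0 < 5)%N.
  move: (s %/ 5)%N (s %% 5)%N (n %/ 5)%N n5 => u r v.
  by case: r => [|[|[|[|[|//]]]]] [] ->; nia.
have ne2 : n <> (s.+1 * s.+1 + 'C(s.+2, 2))%N.
  move=> e; have {t2}: (2 * n = s.+1 * s.+1 * 2 + s.+1 * s.+2)%N by nia.
  rewrite (divn_eq n 5) (divn_eq s 5); have := ltn_pmod s (isT : 0 < 5)%N.
  move: (s %/ 5)%N (s %% 5)%N (n %/ 5)%N n5 => u r v.
  by case: r => [|[|[|[|[|//]]]]] [] ->; nia.
rewrite -signr_odd; case: (odd _); rewrite /= ?expr1 ?expr0 ?mulN1r ?mul1r ?seriesNE seriesDE !qvXE.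
  by move/eqP/negbTE: ne1 => ->; move/eqP/negbTE: ne2 => ->.
by move/eqP/negbTE: ne1 => ->; move/eqP/negbTE: ne2 => ->.
Qed.

(** * Quadratic relations between theta series *)

(** f_1(-q) f_1(q) f_4 = f_2^3: the factors of odd index pair up to 1 - q^(2k). *)
Lemma euler_twist : euler * twist euler * sub 4 euler = sub 2 euler ^+ 3.
Proof.
have fin N : euler_poly N.*2 * twist (euler_poly N.*2) * sub 4 (euler_poly N) =
    sub 2 (euler_poly N.*2) * sub 2 (euler_poly N) ^+ 2.
  elim: N => [|N IHN].
    by rewrite double0 /euler_poly !big_geq // !sub_morph !twist_morph; ring.
  rewrite doubleS !euler_polyS !twist_morph !sub_morph twist_qv !sub_qv !(exprNn qv).
  rewrite -(signr_odd _ N.*2.+2) -(signr_odd _ N.*2.+1) /= odd_double /= expr0 expr1.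
  have -> : qv ^+ N.*2.+2 = (qv ^+ N.+1) ^+ 2 :> series by rewrite -exprM; congr (_ ^+ _); lia.
  have -> : (qv ^+ 2) ^+ N.+1 = (qv ^+ N.+1) ^+ 2 :> series by rewrite -!exprM mulnC.
  have -> : (qv ^+ 4) ^+ N.+1 = (qv ^+ N.+1) ^+ 4 :> series by rewrite -!exprM mulnC.
  have -> : (qv ^+ 2) ^+ N.*2.+1 = (qv ^+ N.*2.+1) ^+ 2 :> series by rewrite -!exprM mulnC.
  have -> : (qv ^+ 2) ^+ N.*2.+2 = (qv ^+ N.+1) ^+ 4 :> series by rewrite -!exprM; congr (_ ^+ _); lia.
  set x := qv ^+ N.+1; set y := qv ^+ N.*2.+1.
  transitivity (euler_poly N.*2 * twist (euler_poly N.*2) * sub 4 (euler_poly N) *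
    ((1 - y ^+ 2) * (1 - x ^+ 2) ^+ 2 * (1 - x ^+ 4))); first by ring.
  by rewrite IHN; ring.
apply: approx_eq => N; have a1 := @euler_approx N; have a2 := @euler_approx N.*2.
apply: (@approx_trans _ _ (euler_poly N.*2 * twist (euler_poly N.*2) * sub 4 (euler_poly N))).
  have {}a2 := approx_le (_ : N <= N.*2)%N a2.
  apply: approxM; last exact: approx_sub.
  by apply: approxM; [| apply: approx_twist]; apply: a2; lia.
rewrite fin exprS; apply/approx_sym/approxM.
  by apply/approx_sub/(approx_le (_ : N <= N.*2)%N a2); lia.
exact (approxX 2 (approx_sub 1 a1)).
Qed.

Lemma phi_twist_phi : phi * twist phi = sub 2 (twist phi) ^+ 2.
Proof.
have g := gauss_phi; have gt := congr1 twist g.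
rewrite !twist_morph twistK twist_sub_even // in gt.
have g2 := congr1 (sub 2) g; rewrite !sub_morph subM in g2.
have e := euler_twist.
set f1 := euler in g gt g2 e; set f1' := twist f1 in gt e.
set f2 := sub 2 f1 in g gt g2 e; set f4 := sub 4 f1 in g2 e.
have f20 : (f2 ^+ 2 * f4 ^+ 2) 0%N = 1.
  by rewrite seriesM0 !seriesX0 !sub_coef0 euler0 !expr1n.
apply: (series_cancel f20).
transitivity ((twist phi * f2) * (phi * f2) * f4 ^+ 2); first by ring.
rewrite g gt; transitivity ((f1 * f1' * f4) ^+ 2); first by ring.
rewrite e; transitivity (f2 ^+ 2 * (f2 ^+ 2) ^+ 2); first by ring.
by rewrite -g2; ring.
Qed.

Lemma twist_phi_dissection : twist phi = sub 4 phi - 2 * qv * sub 8 psi.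
Proof.
by rewrite {1}phi_dissection !twist_morph twist_qv !twist_sub_even //; ring.
Qed.

Lemma sub_inj k (f g : series) : (0 < k)%N -> sub k f = sub k g -> f = g.
Proof. by move=> k_gt0 /(congr1 (section k 0)); rewrite !section_sub. Qed.

(** The relation phi(q) phi(-q) = phi(-q^2)^2, read through the dissection of phi,
is an identity between series in q^2. *)
Lemma twist_phi_square : twist phi ^+ 2 = sub 2 phi ^+ 2 - 4 * qv * sub 4 psi ^+ 2.
Proof.
apply: (@sub_inj 2) => //; rewrite !sub_morph sub_qv !subM -phi_twist_phi.
by rewrite twist_phi_dissection {1}phi_dissection; ring.
Qed.

Lemma phi_square : phi ^+ 2 = sub 2 phi ^+ 2 + 4 * qv * sub 4 psi ^+ 2.
Proof.
have := congr1 twist twist_phi_square.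
by rewrite !twist_morph twistK twist_qv !twist_sub_even // => ->; ring.
Qed.

Lemma psi_square : psi ^+ 2 = phi * sub 2 psi.
Proof.
apply: (@sub_inj 4) => //; rewrite !sub_morph !subM.
apply: (@nat_cancel 3); apply: qv_cancel.
have e := phi_square; have e2 := congr1 (sub 2) e.
rewrite !sub_morph !subM sub_qv in e2; rewrite e2 {1}phi_dissection in e.
transitivity (sub 4 phi ^+ 2 + 4 * qv ^+ 2 * sub 8 psi ^+ 2 +
   4 * qv * sub 4 psi ^+ 2 - (sub 4 phi ^+ 2 + 4 * qv ^+ 2 * sub 8 psi ^+ 2)); first by ring.
by rewrite -e; ring.
Qed.

Lemma phi4_sub_twist : phi ^+ 4 - twist phi ^+ 4 = 16 * (qv * sub 2 psi ^+ 4).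
Proof.
have e := congr1 (sub 2) psi_square; rewrite !sub_morph subM in e.
transitivity ((phi ^+ 2) ^+ 2 - (twist phi ^+ 2) ^+ 2); first by ring.
rewrite phi_square twist_phi_square.
transitivity (16 * (qv * (sub 2 phi * sub 4 psi) ^+ 2)); first by ring.
by rewrite -e; ring.
Qed.

Lemma series_mul_low n (f g : series) : (forall i, (i < n)%N -> f i = 0) ->
  (f * g) n = f n * g 0%N.
Proof.
move=> f0; rewrite seriesME big_ord_recr /= subnn big1 ?add0r // => i _.
by rewrite f0 // mul0r.
Qed.

(** The ratio of A and B would be a series g with g(q)^2 = g(q^2) and g(0) = 1;
its first coefficient of positive index has to vanish. *)
Lemma square_sub2_inj (A B : series) : A 0%N = 1 -> B 0%N = 1 ->
  A ^+ 2 * sub 2 B = B ^+ 2 * sub 2 A -> A = B.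
Proof.
move=> A0 B0 AB; apply: seriesP; elim/ltn_ind=> -[|n] IHn; first by rewrite A0 B0.
have d0 i : (i < n.+1)%N -> (A - B) i = 0 by move=> lt_in; rewrite seriesBE IHn // subrr.
have e0 i : (i <= n.+1)%N -> sub 2 (A - B) i = 0.
  by move=> le_in; rewrite subE; case: ifP => // _; apply: d0; lia.
have: ((A - B) * ((A + B) * sub 2 B)) n.+1 = (sub 2 (A - B) * B ^+ 2) n.+1.
  congr (coefs _ _); rewrite !sub_morph.
  transitivity (A ^+ 2 * sub 2 B - B ^+ 2 * sub 2 B); first by ring.
  by rewrite AB; ring.
rewrite !series_mul_low //; last by move=> i /ltnW; apply: e0.
rewrite e0 // mul0r (seriesDE A B) A0 B0 sub_coef0 B0 seriesBE mulr1.
by move/eqP; rewrite mulf_eq0 orbF subr_eq0 => /eqP.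
Qed.

Lemma phi_euler : phi * euler ^+ 2 * sub 4 euler ^+ 2 = sub 2 euler ^+ 5.
Proof.
have g := gauss_phi; have g2 := congr1 (sub 2) g; rewrite !sub_morph subM in g2.
rewrite -g; transitivity (phi * twist phi * sub 2 euler * sub 4 euler ^+ 2); first by ring.
rewrite phi_twist_phi.
transitivity (sub 2 euler * (sub 2 (twist phi) * sub 4 euler) ^+ 2); first by ring.
by rewrite g2; ring.
Qed.

(** The series f_2^2 / f_1 satisfies the functional equation
psi(q)^2 = phi(q) psi(q^2), which determines psi by [square_sub2_inj]. *)
Lemma psi_euler : psi * euler = sub 2 euler ^+ 2.
Proof.
apply: square_sub2_inj.
- by rewrite seriesM0 psi0 euler0.
- by rewrite seriesX0 sub_coef0 euler0 expr1n.
rewrite !sub_morph subM exprMn psi_square.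
transitivity (phi * euler ^+ 2 * sub 4 euler ^+ 2 * sub 2 psi); first by ring.
by rewrite phi_euler; ring.
Qed.

(** * Logarithmic derivatives *)

Lemma theta_sub_euler k :
  theta (sub k euler) = - (k%:R * sub k euler * sub k (sigma 1)).
Proof. by rewrite theta_sub theta_euler !sub_morph; ring. Qed.

Lemma sub_euler0 k n : (sub k euler ^+ n) 0%N = 1.
Proof. by rewrite seriesX0 sub_coef0 euler0 expr1n. Qed.

Lemma theta_twist_phi :
  theta (twist phi) = twist phi * (2 * sub 2 (sigma 1) - 2 * sigma 1).
Proof.
have := congr1 theta gauss_phi; rewrite thetaM thetaX theta_sub_euler theta_euler => e.
apply: (series_cancel (sub_euler0 2 1)); rewrite expr1.
transitivity ((theta (twist phi) * sub 2 euler +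
   twist phi * - (2%:R * sub 2 euler * sub 2 (sigma 1))) +
   2 * twist phi * sub 2 euler * sub 2 (sigma 1)); first by ring.
rewrite e.
transitivity (2 * twist phi * sub 2 euler * sub 2 (sigma 1) - 2 * euler ^+ 2 * sigma 1).
  by rewrite /=; ring.
by rewrite -gauss_phi; ring.
Qed.

Lemma theta_psi : theta psi = psi * (sigma 1 - 4 * sub 2 (sigma 1)).
Proof.
have := congr1 theta psi_euler; rewrite thetaM thetaX theta_sub_euler theta_euler => e.
apply: (series_cancel euler0).
transitivity (theta psi * euler + psi * - (euler * sigma 1) + psi * euler * sigma 1);
  first by ring.
rewrite e /=.
transitivity (psi * euler * sigma 1 - 4 * sub 2 euler ^+ 2 * sub 2 (sigma 1)).
  by ring.
by rewrite -psi_euler; ring.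
Qed.

Lemma theta_phi : theta phi =
  phi * (2 * sigma 1 - 10 * sub 2 (sigma 1) + 8 * sub 4 (sigma 1)).
Proof.
have := congr1 theta phi_euler; rewrite !(thetaX, thetaM) !theta_sub_euler theta_euler /= => e.
have f0 : (euler ^+ 2 * sub 4 euler ^+ 2) 0%N = 1.
  by rewrite seriesM0 sub_euler0 seriesX0 euler0 expr1n mulr1.
apply: (series_cancel f0).
set s1 := sigma 1 in e *; set s2 := sub 2 s1 in e *; set s4 := sub 4 s1 in e *.
set f1 := euler in e *; set f2 := sub 2 f1 in e *; set f4 := sub 4 f1 in e *.
move: e; set L := (X in X = _ -> _) => e.
transitivity (L + phi * f1 ^+ 2 * f4 ^+ 2 * (2 * s1 + 8 * s4)).
  by rewrite /L; ring.
rewrite e.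
transitivity (phi * f1 ^+ 2 * f4 ^+ 2 * (2 * s1 + 8 * s4) - 10 * f2 ^+ 5 * s2); first by ring.
by have <- : phi * f1 ^+ 2 * f4 ^+ 2 = f2 ^+ 5 := phi_euler; ring.
Qed.

(** * The four and eight squares theorems *)

Lemma twist_powers k :
  twist (powers k) = (2 ^ k.+1)%:R * sub 2 (powers k) - powers k.
Proof.
apply: seriesP => n; rewrite seriesBE series_natME twistE subE !powersE -signr_odd.
case: ifP => [|n2]; last first.
  have -> : odd n by rewrite dvdn2 in n2; move/negbFE: n2.
  by rewrite mulr0 expr1; ring.
move=> /dvdnP[m ->]; rewrite mulnK // oddM andbF expr0 mul1r muln_eq0 orbF.
by case: eqP => _ /=; rewrite ?mulr0n ?mulr1n ?natrM ?exprMn ?natrX ?exprS; ring.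
Qed.

Lemma twist_sigma k : twist (sigma k) =
  ((2 ^ k.+1)%:R + 2) * sub 2 (sigma k) - sigma k - (2 ^ k.+1)%:R * sub 4 (sigma k).
Proof.
rewrite /sigma twist_lambert // twist_powers.
rewrite !(lambertB, lambert_nat) lambert_sub // !sub_morph subM; ring.
Qed.

(** The coefficient of q^n in theta f = f h expresses (n - 1) f_n by earlier
coefficients, so f_1 determines f. *)
Lemma ode_unique (f g h : series) : h 0%N = 1 -> f 1%N = g 1%N ->
  theta f = f * h -> theta g = g * h -> f = g.
Proof.
move=> h0 fg1 tf tg; apply: subr0_eq; set d := f - g.
have td : theta d = d * h by rewrite thetaB tf tg mulrBl.
have d1 : d 1%N = 0 by rewrite seriesBE fg1 subrr.
apply: seriesP => n; rewrite series0E; elim/ltn_ind: n => n IHn.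
have := congr1 (fun u : series => u n) td.
rewrite /= thetaE series_mul_low // h0 mulr1 => /eqP.
rewrite -subr_eq0 -{2}[d n]mul1r -mulrBl mulf_eq0 => /orP[|/eqP //].
by rewrite subr_eq0 pnatr_eq1 => /eqP ->.
Qed.

Section EightSquares.
Local Notation s := (sigma 1).
Local Notation s2 := (sub 2 s).
Local Notation s4 := (sub 4 s).
Local Notation S := (sigma 3).
Local Notation S2 := (sub 2 S).
Local Notation S4 := (sub 4 S).
Local Notation a := (phi ^+ 4).
Local Notation b := (twist phi ^+ 4).
Local Notation c := (qv * sub 2 psi ^+ 4).
Local Notation X := (s - 3 * s2 + 2 * s4).

Lemma twist_sigma1 : twist s = 6 * s2 - s - 4 * s4.
Proof. by rewrite twist_sigma; ring. Qed.
Lemma twist_sigma3 : twist S = 18 * S2 - S - 16 * S4.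
Proof. by rewrite twist_sigma; ring. Qed.

(** The level 2 identity minus the two instances, at q and q^2, of Ramanujan's
equation isolates the mixed product. *)
Lemma sigma_sub2_product : 24 * (s * s2) =
  s + s2 + 2 * S + 8 * S2 - 3 * theta s - 12 * sub 2 (theta s).
Proof.
have R := sigma_square.
have R2 := congr1 (sub 2) R; rewrite !sub_morph in R2.
have /= := twisted_sigma_square; rewrite !twist_powers !(lambertB, lambert_nat).
rewrite !lambert_sub // -!/(sigma _) => R'.
rewrite thetaB theta_natM theta_sub in R'.
set ts := theta s in R R2 R' *; set ts2 := sub 2 ts in R2 R' *.
apply: (@nat_cancel 3); apply: subr0_eq.
pose D1 := 12 * s ^+ 2 - (s + 5 * S - 6 * ts).
pose D2 := 12 * s2 ^+ 2 - (s2 + 5 * S2 - 6 * ts2).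
move: R'; set L := (X in X = _); set M := (X in _ = X) => R'.
transitivity (D1 + 16 * D2 - 3 * (L - M)); first by rewrite /D1 /D2 /L /M; ring.
by rewrite /D1 /D2 R R2 R' !subrr; ring.
Qed.

(** X is the odd part of the sum of sigma_1(n) q^n.  The odd parts of the two
quadratic identities are linear in X s(q^2), X s(q^4) and the odd part of the
sigma_3 series, and the latter is eliminated. *)
Lemma theta_sigma_odd : theta X = X * (1 + 8 * s2 - 32 * s4).
Proof.
have R := sigma_square.
have Rt := congr1 twist R.
rewrite !twist_morph -theta_twist twist_sigma1 twist_sigma3 in Rt.
have P := sigma_sub2_product; have Pt := congr1 twist P.
rewrite !twist_morph -theta_twist !twist_sub_even // twist_sigma1 twist_sigma3 in Pt.
rewrite !(thetaB, theta_natM) in Rt Pt.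
rewrite thetaD thetaB !theta_natM.
set ts := theta s in R Rt P Pt *.
set ts2 := theta s2 in R Rt P Pt *; set ts4 := theta s4 in Rt Pt *.
set us2 := sub 2 ts in P Pt.
apply: (@nat_cancel 5); apply: subr0_eq.
move: R; set R1 := (X in X = _); set R2 := (X in _ = X) => R.
move: Rt; set Rt1 := (X in X = _); set Rt2 := (X in _ = X) => Rt.
move: P; set P1 := (X in X = _); set P2 := (X in _ = X) => P.
move: Pt; set Pt1 := (X in X = _); set Pt2 := (X in _ = X) => Pt.
transitivity (2 * ((Rt1 - Rt2) - (R1 - R2)) + 5 * ((P1 - P2) - (Pt1 - Pt2))).
  by rewrite /R1 /R2 /Rt1 /Rt2 /P1 /P2 /Pt1 /Pt2; ring.
by rewrite R Rt P Pt !subrr; ring.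
Qed.

Lemma theta_psi_sub2 : theta c = c * (1 + 8 * s2 - 32 * s4).
Proof.
by rewrite thetaM theta_qv thetaX theta_sub theta_psi !sub_morph subM /=; ring.
Qed.

Lemma psi4_sigma_odd : c = X.
Proof.
apply: (ode_unique _ _ theta_psi_sub2 theta_sigma_odd).
  rewrite !(seriesDE, seriesNE, series_natME) !sub_coef0 lambert0 series1E.
  by rewrite !mulr0 addr0 subr0.
rewrite qvMS seriesX0 sub_coef0 psi0 expr1n.
rewrite !(seriesDE, seriesNE, series_natME) !subE /= /sigma lambertE.
by rewrite big_nat1 sub1 powersE !mulr0 subr0 addr0.
Qed.

(** With A, B, C the logarithmic derivatives of a, b and a - b one has
aA - bB = (a - b)C and A - B = a - b, whence b = C - A. *)
Lemma twist_phi4_eisenstein : b = 1 - 8 * s + 48 * s2 - 64 * s4.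
Proof.
have ta : theta a = a * (8 * s - 40 * s2 + 32 * s4).
  by rewrite thetaX theta_phi /=; ring.
have tb : theta b = b * (8 * s2 - 8 * s).
  by rewrite thetaX theta_twist_phi /=; ring.
have tab := congr1 theta phi4_sub_twist.
rewrite thetaB ta tb theta_natM theta_psi_sub2 in tab.
have p0 : (sub 2 psi ^+ 4) 0%N = 1 by rewrite seriesX0 sub_coef0 psi0 expr1n.
apply: (series_cancel p0); apply: qv_cancel; apply: (@nat_cancel 15).
set cp := sub 2 psi ^+ 4 in p0 *.
have cE f : 16%:R * (qv * (cp * f)) = (a - b) * f.
  by rewrite phi4_sub_twist -/cp; ring.
have eX : a - b = 16 * X by rewrite phi4_sub_twist psi4_sigma_odd.
rewrite [LHS]cE [RHS]cE.
have tab' : (a - b) * (1 + 8 * s2 - 32 * s4) =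
    a * (8 * s - 40 * s2 + 32 * s4) - b * (8 * s2 - 8 * s).
  by rewrite tab phi4_sub_twist; ring.
transitivity (b * (a - b)); first by rewrite mulrC.
rewrite {1}eX.
transitivity (a * (8 * s - 40 * s2 + 32 * s4) - b * (8 * s2 - 8 * s)
  - (a - b) * (8 * s - 40 * s2 + 32 * s4)); first by ring.
by rewrite -tab'; ring.
Qed.

Lemma phi4_eisenstein : a = 1 + 8 * s - 32 * s4.
Proof.
have -> : a = b + 16 * X by rewrite -psi4_sigma_odd -phi4_sub_twist addrC subrK.
by rewrite twist_phi4_eisenstein; ring.
Qed.

(** The derivative of the four squares formula for a is computed in two ways: by
Ramanujan's equation and as a times the logarithmic derivative of a. *)
Lemma phi4_form : a ^+ 2 - 2 * (a * b) = - 1 + 16 * S - 256 * S4.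
Proof.
have R := sigma_square.
have R4 := congr1 (sub 4) R; rewrite !sub_morph in R4.
have ta : theta a = a * (8 * s - 40 * s2 + 32 * s4).
  by rewrite thetaX theta_phi /=; ring.
have := congr1 theta phi4_eisenstein.
rewrite ta thetaB thetaD theta1 !theta_natM theta_sub => T.
set ts := theta s in R R4 T; set ts4 := sub 4 ts in R4 T.
apply: (@nat_cancel 4); apply: subr0_eq.
rewrite twist_phi4_eisenstein; rewrite phi4_eisenstein in T *.
move: R; set R1 := (X in X = _); set R2 := (X in _ = X) => R.
move: R4; set R41 := (X in X = _); set R42 := (X in _ = X) => R4.
move: T; set T1 := (X in X = _); set T2 := (X in _ = X) => T.
transitivity (16 * (R1 - R2) - 256 * (R41 - R42) + 12 * (T1 - T2)).
  by rewrite /R1 /R2 /R41 /R42 /T1 /T2; ring.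
by rewrite R R4 T (subrr R2) (subrr R42) (subrr T2) !mulr0 subrr addr0.
Qed.

Lemma double_sub2_eq0 (f : series) : f = 2 * sub 2 f -> f = 0.
Proof.
move=> f2; apply: seriesP => n; rewrite series0E; elim/ltn_ind: n => n IHn.
have := congr1 (fun u : series => u n) f2; rewrite /= series_natME subE.
case: ifP => [|_ ->]; last by rewrite mulr0.
case: n IHn => [|n] IHn n2; first by rewrite div0n; lra.
by move=> ->; rewrite IHn ?mulr0 //; lia.
Qed.

Lemma phi4_twist_phi4_sub2 : a * b = sub 2 (b ^+ 2).
Proof.
by rewrite -exprMn phi_twist_phi !sub_morph -!exprM.
Qed.

(** At -q, [phi4_form] evaluates b^2 - 2ab, and ab is b^2 at q^2. *)
Lemma twist_phi8_eisenstein : b ^+ 2 = 1 - 16 * S + 256 * S2.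
Proof.
apply: subr0_eq; apply: double_sub2_eq0.
rewrite [sub 2 (_ - _)]sub_add sub_opp -phi4_twist_phi4_sub2 !sub_morph.
rewrite subM.
have := congr1 twist phi4_form; rewrite !twist_morph twistK twist_sigma3 twist_sub_even // => K.
apply: subr0_eq; move: K; set K1 := (X in X = _); set K2 := (X in _ = X) => K.
transitivity (K1 - K2); last by rewrite K subrr.
by rewrite /K1 /K2; ring.
Qed.

Lemma phi4_twist_phi4_eisenstein : a * b = 1 - 16 * S2 + 256 * S4.
Proof. by rewrite phi4_twist_phi4_sub2 twist_phi8_eisenstein !sub_morph subM. Qed.

Lemma phi8_eisenstein : a ^+ 2 = 1 + 16 * S - 32 * S2 + 256 * S4.
Proof.
by have := phi4_form; rewrite phi4_twist_phi4_eisenstein => /(canRL (subrK _)) ->; ring.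
Qed.
End EightSquares.

(** * The generating function of overpartitions *)

(** The continuations of an overpartition that has reached the part size m: all
parts are at most m, and a part m may be overlined only if [f] holds, that is if
no m has occurred yet. *)
Fixpoint overpart_below (m : nat) (f : bool) (s : seq (nat * bool)) : bool :=
  if s is (k, o) :: t then
    [&& (0 < k)%N, (k <= m)%N, o ==> (k < m)%N || f & overpart_below k false t]
  else true.

(** The condition on overlined parts for the tail [s] of a sequence whose earlier
parts are [pre]. *)
Definition marks_ok (pre : seq nat) (s : seq (nat * bool)) :=
  all (fun i => nth false (unzip2 s) i ==> (nth 0%N (unzip1 s) i \notin pre ++ take i (unzip1 s)))
      (iota 0 (size s)).

Lemma marks_ok_cons pre k o t :
  marks_ok pre ((k, o) :: t) = (o ==> (k \notin pre)) && marks_ok (k :: pre) t.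
Proof.
rewrite /marks_ok /= cats0; congr (_ && _).
rewrite (iotaDl 1 0) all_map; apply: eq_all => i /=; congr (_ ==> _); congr (~~ _).
by rewrite !mem_cat !inE mem_cat orbCA.
Qed.

Lemma overpart_below_spec m pre s : all (leq m) pre ->
  overpart_below m (m \notin pre) s =
  [&& path geq m (unzip1 s), all (leq 1) (unzip1 s) & marks_ok pre s].
Proof.
elim: s m pre => [|[k o] t IHs] m pre le_pre //=.
rewrite marks_ok_cons; case: (leqP k m) => [le_km|_]; last by rewrite andbF.
have le_pre' : all (leq k) (k :: pre).
  by rewrite /= leqnn; apply: sub_all le_pre => x; apply: leq_trans.
have := IHs k (k :: pre) le_pre'; rewrite inE eqxx /= => ->.
have -> : (k < m)%N || (m \notin pre) = (k \notin pre).
  move: le_km; rewrite leq_eqVlt => /orP[/eqP ->|lt_km]; first by rewrite ltnn.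
  rewrite lt_km; apply/esym/negP => /(allP le_pre); rewrite leqNgt lt_km //.
set A := all (leq 1) _; set M := marks_ok _ _.
set P := path _ _ _; set I := (_ ==> _).
by case: (0 < k)%N; case: P; case: A; case: I; case: M.
Qed.

Lemma is_overpartitionE m n s : (n <= m)%N ->
  is_overpartition n s = overpart_below m true s && (sumn (unzip1 s) == n).
Proof.
move=> le_nm; rewrite (@overpart_below_spec m [::]) // /is_overpartition.
rewrite -/(marks_ok [::] s).
rewrite !andbA [in RHS]andbAC; congr (_ && _); rewrite [in RHS]andbAC.
case: eqP => [def_n|]; rewrite ?andbF // !andbT; congr (_ && _).
case: s def_n => [|[k o] t] //= def_n.
by rewrite /geq /= (leq_trans _ le_nm) // -def_n leq_addr.
Qed.

(** A list of the sequences described by [overpart_below] with sum [n]; the fuel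
must exceed m + n. *)
Fixpoint overparts (fuel m : nat) (f : bool) (n : nat) : seq (seq (nat * bool)) :=
  if fuel is k.+1 then
    if m is m'.+1 then
      overparts k m' true n ++
      (if (m <= n)%N then
        [seq (m, false) :: t | t <- overparts k m false (n - m)] ++
        (if f then [seq (m, true) :: t | t <- overparts k m false (n - m)] else [::])
       else [::])
    else if n == 0%N then [:: [::]] else [::]
  else [::].

Lemma overpartsS k m f n : overparts k.+1 m.+1 f n =
  overparts k m true n ++
  (if (m < n)%N then
    [seq (m.+1, false) :: t | t <- overparts k m.+1 false (n - m.+1)] ++
    (if f then [seq (m.+1, true) :: t | t <- overparts k m.+1 false (n - m.+1)] else [::])
   else [::]).
Proof. by []. Qed.

Lemma cons_inj (x : nat * bool) : injective (cons x).
Proof. by move=> s t []. Qed.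

Lemma mem_map_cons (x y : nat * bool) t l :
  (y :: t \in [seq x :: u | u <- l]) = (y == x) && (t \in l).
Proof.
by apply/mapP/andP => [[u ul [-> ->]]|[/eqP -> tl]]; [rewrite eqxx | exists t].
Qed.

Lemma nil_map_cons (x : nat * bool) l : ([::] \in [seq x :: u | u <- l]) = false.
Proof. by apply/mapP => -[]. Qed.

Lemma mem_overparts fuel m f n s : (m + n < fuel)%N ->
  (s \in overparts fuel m f n) = overpart_below m f s && (sumn (unzip1 s) == n).
Proof.
elim: fuel m f n s => // k IHk [|m] f n s lt_k /=.
  case: s => [|[[|a] b] t] /=.
  - by rewrite eq_sym; case: eqP.
  - by case: ifP.
  - by case: ifP.
rewrite mem_cat IHk; last by lia.
have e1 t : (m < n)%N -> (t \in overparts k m.+1 false (n - m.+1)) =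
    overpart_below m.+1 false t && (sumn (unzip1 t) == n - m.+1)%N.
  by move=> lt; apply: IHk; lia.
case: s => [|[a b] t] /=.
  case: ifP => _; rewrite ?in_nil ?orbF // mem_cat nil_map_cons /=.
  by case: f; rewrite ?nil_map_cons ?orbF.
set T := overpart_below a false t.
have -> : ((a, b) :: t \in (if (m < n)%N
   then [seq (m.+1, false) :: t | t <- overparts k m.+1 false (n - m.+1)] ++
    (if f then [seq (m.+1, true) :: t | t <- overparts k m.+1 false (n - m.+1)] else [::])
   else [::])) =
   [&& a == m.+1, b ==> f, T & (a + sumn (unzip1 t) == n)%N].
  case: (ltnP m n) => [lt_mn|le_nm]; last first.
    rewrite in_nil; case: eqP => //= ->; rewrite andbC; case: eqP => //; lia.
  rewrite mem_cat mem_map_cons e1 // xpair_eqE.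
  have -> : ((a, b) :: t \in if f
      then [seq (m.+1, true) :: t | t <- overparts k m.+1 false (n - m.+1)] else [::]) =
      f && ((a == m.+1) && b) && (overpart_below m.+1 false t && (sumn (unzip1 t) == n - m.+1)%N).
    by case: f => //; rewrite mem_map_cons e1 // xpair_eqE eqb_id.
  rewrite /T; case: (eqVneq a m.+1) => [->|]; rewrite ?andbF //=.
  have -> : (sumn (unzip1 t) == n - m.+1)%N = (m.+1 + sumn (unzip1 t) == n)%N by lia.
  by case: b; case: f; rewrite /= ?andbF ?orbF.
rewrite -/T; case: (ltngtP a m.+1) => [lt_am|gt|eq_am]; rewrite ?andbF ?orbF //=.
- by rewrite (lt_am : (a <= m)%N) orbT implybT.
- by rewrite [(a <= m)%N]leqNgt (ltnW gt) andbF.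
- by rewrite eq_am ltnn /= -!andbA.
Qed.

Lemma overparts_uniq fuel m f n : (m + n < fuel)%N -> uniq (overparts fuel m f n).
Proof.
elim: fuel m f n => // k IHk [|m] f n lt_k /=; first by case: ifP.
rewrite cat_uniq IHk ?andTb; last by lia.
case: ifP => // lt_mn.
have u : uniq (overparts k m.+1 false (n - m.+1)) by apply: IHk; lia.
rewrite cat_uniq (map_inj_uniq (@cons_inj _)) u /=.
apply/andP; split.
  apply/hasPn => s; rewrite mem_cat => sm; rewrite /= mem_overparts; last by lia.
  have [t [b ->]] : exists t b, s = (m.+1, b) :: t.
    case/orP: sm => [/mapP[t _ ->]|]; first by exists t, false.
    by case: f => // /mapP[t _ ->]; exists t, true.
  by rewrite /= ltnn.
case: f => //=; rewrite (map_inj_uniq (@cons_inj _)) u.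
rewrite andbT; apply/hasPn => s /mapP[t _ ->] /=.
by rewrite mem_map_cons xpair_eqE andbF.
Qed.

Definition overpart_series m f : series :=
  Series (fun n => (size (overparts (m + n).+1 m f n))%:R).

Lemma size_overparts fuel m f n : (m + n < fuel)%N ->
  (size (overparts fuel m f n))%:R = overpart_series m f n.
Proof.
move=> lt; congr (_%:R); apply: perm_size; apply: uniq_perm.
- exact: overparts_uniq.
- exact: overparts_uniq.
by move=> s; rewrite !mem_overparts.
Qed.

Lemma overpart_series_rec m f : overpart_series m.+1 f =
  overpart_series m true + (f.+1)%:R * (qv ^+ m.+1 * overpart_series m.+1 false).
Proof.
apply: seriesP => n; rewrite seriesDE series_natME qvXM.
rewrite -(@size_overparts (m.+1 + n).+1) // overpartsS size_cat natrD.
rewrite size_overparts; last by lia.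
congr (_ + _); case: ifP => lt_mn; last by rewrite mulr0.
rewrite size_cat size_map natrD size_overparts; last by lia.
case: f; rewrite ?size_map ?size_overparts //=; try lia; ring.
Qed.

(** A block of parts m contributes 1 + 2 (q^m + q^(2m) + ...), which is
(1 + q^m) / (1 - q^m). *)
Lemma overpart_seriesE m :
  overpart_series m true * euler_poly m = plus_poly m.
Proof.
elim: m => [|m IHm].
  rewrite /euler_poly /plus_poly !big_geq // mulr1.
  by apply: seriesP => -[|n]; rewrite series1E.
set u := overpart_series m true; set v := overpart_series m.+1 false.
have r1 : v = u + 1%:R * (qv ^+ m.+1 * v) := overpart_series_rec m false.
have r2 : overpart_series m.+1 true = u + 2%:R * (qv ^+ m.+1 * v) :=
  overpart_series_rec m true.
rewrite euler_polyS plus_polyS -IHm r2 -/u.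
have -> : u = v * (1 - qv ^+ m.+1).
  transitivity (v - 1%:R * (qv ^+ m.+1 * v)); first by rewrite {1}r1 addrK.
  ring.
ring.
Qed.

Definition overpartitions : series := Series (fun n => (overpartition_number n)%:R).

Lemma overpartitions_approx N : approx N overpartitions (overpart_series N true).
Proof.
move=> n le_nN; congr (_%:R); apply: overpartition_numberE.
  exact: overparts_uniq.
by move=> s; rewrite mem_overparts // (@is_overpartitionE N).
Qed.

Lemma overpartitions_phi : overpartitions * twist phi = 1.
Proof.
have e : overpartitions * euler ^+ 2 = sub 2 euler.
  apply: approx_eq => N; have ae := @euler_approx N.
  refine (approx_trans (approxM (@overpartitions_approx N) (approxX 2 ae)) _).
  refine (approx_trans _ (approx_sub 1 (approx_sym ae))).
  by rewrite expr2 mulrA overpart_seriesE plus_euler_poly.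
apply: (series_cancel (sub_euler0 2 1)); rewrite expr1.
transitivity (overpartitions * (twist phi * sub 2 euler)); first by ring.
by rewrite gauss_phi e mulr1.
Qed.

(** * Overpartitions of 16k + 4 and 16k + 8 *)

Lemma overpartitions_twist_phi4 :
  overpartitions * sub 4 (twist phi) ^+ 4 = phi * sub 2 phi ^+ 2.
Proof.
have l1 := phi_twist_phi; have l2 := congr1 (sub 2) l1; rewrite !sub_morph !subM in l2.
transitivity (overpartitions * (sub 4 (twist phi) ^+ 2) ^+ 2); first by ring.
rewrite -l2.
transitivity (overpartitions * (sub 2 (twist phi) ^+ 2) * sub 2 phi ^+ 2); first by ring.
rewrite -l1.
transitivity ((overpartitions * twist phi) * phi * sub 2 phi ^+ 2); first by ring.
by rewrite overpartitions_phi mul1r.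
Qed.

Lemma sub2_phi_square : sub 2 phi ^+ 2 = sub 4 phi ^+ 2 + 4 * qv ^+ 2 * sub 8 psi ^+ 2.
Proof.
by have := congr1 (sub 2) phi_square; rewrite !sub_morph !subM sub_qv.
Qed.

Lemma section4_expand (f0 f1 f2 f3 : series) :
  let f := sub 4 f0 + qv * sub 4 f1 + qv ^+ 2 * sub 4 f2 + qv ^+ 3 * sub 4 f3 in
  [/\ section 4 0 f = f0, section 4 1 f = f1 & section 4 2 f = f2].
Proof.
have q0 r (g : series) i : (i < 4)%N -> (r < 4)%N ->
    section 4 r (qv ^+ i * sub 4 g) = if r == i then g else 0.
  move=> lt_i lt_r; rewrite mulrC section_subM //.
  have -> : section 4 r (qv ^+ i) = (r == i)%:R.
    apply: seriesP => n; rewrite sectionE qvXE series_natE mulnb.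
    by congr (nat_of_bool _)%:R; lia.
  by case: eqP => _; rewrite ?mulr1 ?mulr0.
have q1 r (g : series) : (r < 4)%N -> section 4 r (qv * sub 4 g) = if r == 1%N then g else 0.
  by move=> lt_r; exact: (q0 r g 1%N).
by rewrite /= !raddfD /= !q0 // !q1 // !section_sub //= !addr0 !add0r.
Qed.

Lemma section4_overpartitions :
  section 4 0 overpartitions * twist phi ^+ 4 = phi ^+ 3.
Proof.
have e : section 4 0 (sub 4 (twist phi ^+ 4) * overpartitions) = phi ^+ 3.
  have psi8 : sub 8 psi = sub 4 (sub 2 psi) by rewrite subM.
  have [e0 _ _] := section4_expand (phi ^+ 3) (2 * phi ^+ 2 * sub 2 psi)
    (4 * phi * sub 2 psi ^+ 2) (8 * sub 2 psi ^+ 3).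
  rewrite -[RHS]e0 sub_exp mulrC overpartitions_twist_phi4 sub2_phi_square.
  rewrite [X in section 4 0 (X * _) = _]phi_dissection.
  by rewrite psi8 !sub_morph; congr (section _ _ _); ring.
by rewrite -[RHS]e section_subM // mulrC.
Qed.

(** With y = 2q psi(q^8) / phi(q^4), the polynomial (1 + y)^7 (1 + y^2)^4 is split
by the exponent of y modulo 4; its coefficients are palindromic, so two cubic forms
in 1 and y^4 suffice. *)
Definition cubic0 (u v : series) := u ^+ 3 + 125 * u ^+ 2 * v + 323 * u * v ^+ 2 + 63 * v ^+ 3.
Definition cubic1 (u v : series) := 7 * u ^+ 3 + 203 * u ^+ 2 * v + 277 * u * v ^+ 2 + 25 * v ^+ 3.

Lemma cubic_expand (A B q : series) :
  let a := A ^+ 4 in let d := 16 * (q ^+ 4 * B ^+ 4) in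
  (A + 2 * q * B) ^+ 7 * (A ^+ 2 + 4 * q ^+ 2 * B ^+ 2) ^+ 4 =
  A ^+ 3 * cubic0 a d + q * (2 * B * A ^+ 2 * cubic1 a d) +
  q ^+ 2 * (4 * B ^+ 2 * A * cubic1 d a) + q ^+ 3 * (8 * B ^+ 3 * cubic0 d a).
Proof. by rewrite /cubic0 /cubic1 /=; ring. Qed.

Lemma sub_cubic0 k u v : sub k (cubic0 u v) = cubic0 (sub k u) (sub k v).
Proof. by rewrite /cubic0 !sub_morph. Qed.
Lemma sub_cubic1 k u v : sub k (cubic1 u v) = cubic1 (sub k u) (sub k v).
Proof. by rewrite /cubic1 !sub_morph. Qed.

(** By two uses of phi(q) phi(-q) = phi(-q^2)^2 the denominator becomes
phi(-q^4)^16, a series in q^4, so that only the numerator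
phi(q)^7 phi(q^2)^8 has to be dissected. *)
Lemma section16_overpartitions :
  let p := section 4 0 overpartitions in
  let a := phi ^+ 4 in let b := twist phi ^+ 4 in
  section 4 1 p * b ^+ 4 = 2 * sub 2 psi * phi ^+ 2 * cubic1 a (a - b) /\
  section 4 2 p * b ^+ 4 = 4 * sub 2 psi ^+ 2 * phi * cubic1 (a - b) a.
Proof.
move=> p a b; pose d := 16 * (qv * sub 2 psi ^+ 4).
have -> : a - b = d := phi4_sub_twist.
pose A := sub 4 phi; pose B := sub 4 (sub 2 psi).
have dE : sub 4 d = 16 * (qv ^+ 4 * B ^+ 4) by rewrite /d !sub_morph sub_qv.
have aE : sub 4 a = A ^+ 4 by rewrite /a sub_exp.
pose a' := A ^+ 4; pose d' := 16 * (qv ^+ 4 * B ^+ 4).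
have q0 : sub 4 (phi ^+ 3 * cubic0 a d) = A ^+ 3 * cubic0 a' d'.
  rewrite sub_mul sub_exp sub_cubic0 aE dE; exact: erefl.
have q1 : sub 4 (2 * sub 2 psi * phi ^+ 2 * cubic1 a d) =
    2 * B * A ^+ 2 * cubic1 a' d'.
  rewrite 3!sub_mul sub_nat sub_exp sub_cubic1 aE dE; exact: erefl.
have q2 : sub 4 (4 * sub 2 psi ^+ 2 * phi * cubic1 d a) =
    4 * B ^+ 2 * A * cubic1 d' a'.
  rewrite 3!sub_mul sub_nat sub_exp sub_cubic1 aE dE; exact: erefl.
have q3 : sub 4 (8 * sub 2 psi ^+ 3 * cubic0 d a) = 8 * B ^+ 3 * cubic0 d' a'.
  rewrite 2!sub_mul sub_nat sub_exp sub_cubic0 aE dE; exact: erefl.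
have l1 := phi_twist_phi; have l2 := congr1 (sub 2) l1; rewrite !sub_morph !subM in l2.
have pe : p * sub 4 (twist phi) ^+ 16 = phi ^+ 7 * (sub 2 phi ^+ 2) ^+ 4.
  transitivity (p * (sub 4 (twist phi) ^+ 2) ^+ 8); first by ring.
  rewrite -l2; transitivity (p * (sub 2 (twist phi) ^+ 2) ^+ 4 * sub 2 phi ^+ 8); first by ring.
  rewrite -l1; transitivity ((p * twist phi ^+ 4) * phi ^+ 4 * sub 2 phi ^+ 8); first by ring.
  by rewrite section4_overpartitions; ring.
have pe' : sub 4 (b ^+ 4) * p = (A + 2 * qv * B) ^+ 7 * (A ^+ 2 + 4 * qv ^+ 2 * B ^+ 2) ^+ 4.
  have psi8 : B = sub 8 psi by rewrite /B subM.
  rewrite psi8 -phi_dissection -sub2_phi_square -pe mulrC; congr (_ * _).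
  by rewrite /b -exprM sub_exp.
have [_ e1 e2] := section4_expand (phi ^+ 3 * cubic0 a d)
  (2 * sub 2 psi * phi ^+ 2 * cubic1 a d)
  (4 * sub 2 psi ^+ 2 * phi * cubic1 d a) (8 * sub 2 psi ^+ 3 * cubic0 d a).
have key : sub 4 (b ^+ 4) * p =
    A ^+ 3 * cubic0 a' d' + qv * (2 * B * A ^+ 2 * cubic1 a' d') +
    qv ^+ 2 * (4 * B ^+ 2 * A * cubic1 d' a') + qv ^+ 3 * (8 * B ^+ 3 * cubic0 d' a').
  exact: etrans pe' (cubic_expand A B qv).
rewrite -q0 -q1 -q2 -q3 in key.
rewrite -key (section_subM _ _ (isT : (1 < 4)%N)) in e1.
rewrite -key (section_subM _ _ (isT : (2 < 4)%N)) in e2.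
by split; rewrite mulrC; [rewrite -e1 | rewrite -e2].
Qed.

(** * Congruences modulo 25 *)

Definition cong25 (f g : series) := exists h, f = g + 25%:R * h.

Lemma cong25_refl f : cong25 f f. Proof. by exists 0; ring. Qed.
Lemma cong25_trans f g h : cong25 f g -> cong25 g h -> cong25 f h.
Proof. by case=> u -> [v ->]; exists (u + v); ring. Qed.
Lemma cong25_sym f g : cong25 f g -> cong25 g f.
Proof. by case=> u ->; exists (- u); ring. Qed.
Lemma cong25M f f' g g' : cong25 f f' -> cong25 g g' -> cong25 (f * g) (f' * g').
Proof. by case=> u -> [v ->]; exists (f' * v + u * g' + 25 * u * v); ring. Qed.
Lemma cong25X f g k : cong25 f g -> cong25 (f ^+ k) (g ^+ k).
Proof.
by move=> fg; elim: k => [|k IHk]; [exact: cong25_refl | rewrite !exprS; apply: cong25M].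
Qed.

Lemma euler_pow5_sub k :
  cong25 (sub k euler ^+ 5) (sub (k * 5) euler * (1 - 5 * sub k (sigma 3))).
Proof.
have [h e] := euler_pow5; rewrite -sub_exp -subM.
by rewrite e; exists (sub k h); rewrite !sub_morph; ring.
Qed.

Lemma cong25_cancel (f g h : series) : f 0%N = 1 -> cong25 (f * g) (f * h) -> cong25 g h.
Proof.
move=> f0 [u fgh].
have: divides 25 (f * (g - h)).
  by apply/dividesP; exists u; rewrite mulrBr fgh addrC addKr.
move=> /(divides_cancel f0) /dividesP[v e]; exists v.
by rewrite -e addrC subrK.
Qed.

Lemma cong25_linear (c d x y : series) :
  cong25 ((c + 5 * x) * (d + 5 * y)) (c * d + 5 * (c * y + d * x)).
Proof. by exists (x * y); ring. Qed.

Lemma cong25_unit_exp (y : series) k : cong25 ((1 - 5 * y) ^+ k) (1 - 5 * (k%:R * y)).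
Proof.
elim: k => [|k [h IHk]]; first by exists 0; ring.
exists (k%:R * y ^+ 2 + (1 - 5 * y) * h); rewrite exprS IHk -[k.+1%:R]natr1; ring.
Qed.

Lemma cong25_unit5 (y : series) : cong25 ((1 - 5 * y) ^+ 5) 1.
Proof. by have [h ->] := cong25_unit_exp y 5; exists (h - y); ring. Qed.

(** Both sides are f_1^6 as products: psi = f_2^2 / f_1 and
phi(-q) = f_1^2 / f_2. *)
Lemma psi2_twist_phi4 : psi ^+ 2 * twist phi ^+ 4 = euler ^+ 6.
Proof.
apply: (series_cancel (sub_euler0 2 4)).
have e0 : (euler ^+ 2) 0%N = 1 by rewrite seriesX0 euler0 expr1n.
apply: (series_cancel e0).
transitivity ((psi * euler) ^+ 2 * (twist phi * sub 2 euler) ^+ 4); first by ring.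
by rewrite psi_euler gauss_phi; ring.
Qed.

(** If p k(q^5) = g l(q^5), a residue class modulo 5 in which g has no terms has no
terms in p either. *)
Lemma section5_cong (p g k l : series) r : (r < 5)%N -> section 5 r g = 0 ->
    k 0%N = 1 -> cong25 (p * sub 5 k) (g * sub 5 l) -> divides 25 (section 5 r p).
Proof.
move=> lt_r g0 k0 [h e]; apply: (divides_cancel k0); apply/dividesP.
exists (section 5 r h); rewrite -(section_subM _ _ lt_r) mulrC e raddfD /=.
rewrite [g * _]mulrC section_subM // g0 mulr0 add0r.
by apply: seriesP => n; rewrite sectionE !series_natME.
Qed.

(** Here h, t, ps, s2, t2 are phi(q), phi(-q), psi(q), psi(q^2), phi(-q^2).
Multiplication by phi(-q)^9 turns b^4 into phi(-q)^25, hence into f_1^50 / f_2^25,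
and the theta monomial into a product of f_k; modulo 25 the cubic form is a times
12 a^2 - 7 ab + 2 b^2. *)
Lemma theta_quotient_16n4 (p1 f1 f2 f4 h t ps s2 t2 G : series) :
    t * f2 = f1 ^+ 2 -> t2 * f4 = f2 ^+ 2 -> ps ^+ 2 * t ^+ 4 = f1 ^+ 6 ->
    ps ^+ 2 = h * s2 -> h * t = t2 ^+ 2 ->
    p1 * (t ^+ 4) ^+ 4 = 2 * s2 * h ^+ 2 * cubic1 (h ^+ 4) (h ^+ 4 - t ^+ 4) ->
    12 * (h ^+ 4) ^+ 2 - 7 * (h ^+ 4 * t ^+ 4) + 2 * (t ^+ 4) ^+ 2 = G ->
  cong25 (p1 * f1 ^+ 50 * f4 ^+ 10) (2 * f1 ^+ 6 * f2 ^+ 45 * G).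
Proof.
move=> e1 e2 e3 e4 e5 e6 <-; pose a := h ^+ 4; pose b := t ^+ 4.
exists (2 * s2 * h ^+ 2 * (t ^+ 9 * f2 ^+ 25 * f4 ^+ 10) *
        (20 * a ^+ 3 - 33 * a ^+ 2 * b + 14 * a * b ^+ 2 - b ^+ 3)).
transitivity (p1 * (f1 ^+ 2) ^+ 25 * f4 ^+ 10); first by ring.
rewrite -e1.
transitivity (p1 * (t ^+ 4) ^+ 4 * (t ^+ 9 * f2 ^+ 25 * f4 ^+ 10)); first by ring.
have k : f1 ^+ 6 * (f2 ^+ 2) ^+ 10 = s2 * h ^+ 6 * t ^+ 9 * f4 ^+ 10.
  rewrite -e2 -e3 e4; transitivity (h * s2 * t ^+ 4 * (t2 ^+ 2) ^+ 5 * f4 ^+ 10).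
    by ring.
  by rewrite -e5; ring.
have k' : f1 ^+ 6 * f2 ^+ 45 = f2 ^+ 25 * (s2 * h ^+ 6 * t ^+ 9 * f4 ^+ 10).
  by rewrite -k; ring.
by rewrite e6 -(mulrA 2 (f1 ^+ 6)) k' /cubic1 /a /b; ring.
Qed.

(** As in [theta_quotient_16n4]; the coefficient 25 of a^3 drops out, so that the
cubic form is divisible by a - b, with quotient 12 a^2 - 17 ab + 7 b^2. *)
Lemma theta_quotient_16n8 (p2 f1 f2 f4 h t ps s2 G : series) :
    t * f2 = f1 ^+ 2 -> s2 * f2 = f4 ^+ 2 -> ps ^+ 2 * t ^+ 4 = f1 ^+ 6 ->
    ps ^+ 2 = h * s2 -> h ^+ 4 - t ^+ 4 = 16 * (qv * s2 ^+ 4) ->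
    p2 * (t ^+ 4) ^+ 4 = 4 * s2 ^+ 2 * h * cubic1 (h ^+ 4 - t ^+ 4) (h ^+ 4) ->
    12 * (h ^+ 4) ^+ 2 - 17 * (h ^+ 4 * t ^+ 4) + 7 * (t ^+ 4) ^+ 2 = G ->
  cong25 (p2 * f1 ^+ 50) (64 * qv * f1 ^+ 16 * f2 ^+ 15 * f4 ^+ 10 * G).
Proof.
move=> e1 e2 e3 e4 e5 e6 <-; pose a := h ^+ 4; pose b := t ^+ 4.
exists (4 * s2 ^+ 2 * h * (t ^+ 9 * f2 ^+ 25) *
        (a ^+ 3 + (a - b) * (19 * a ^+ 2 - 8 * a * b))).
transitivity (p2 * (f1 ^+ 2) ^+ 25); first by ring.
rewrite -e1.
transitivity (p2 * (t ^+ 4) ^+ 4 * (t ^+ 9 * f2 ^+ 25)); first by ring.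
rewrite e6.
have k : f1 ^+ 6 * (f1 ^+ 2 * f4 ^+ 2) ^+ 5 = s2 ^+ 6 * h * t ^+ 9 * f2 ^+ 10.
  by rewrite -e1 -e2 -e3 e4; ring.
have k' : 64 * qv * f1 ^+ 16 * f2 ^+ 15 * f4 ^+ 10 =
    4 * f2 ^+ 25 * s2 ^+ 2 * h * t ^+ 9 * (h ^+ 4 - t ^+ 4).
  rewrite e5; transitivity (64 * qv * f2 ^+ 15 * (f1 ^+ 6 * (f1 ^+ 2 * f4 ^+ 2) ^+ 5)).
    by ring.
  by rewrite k; ring.
by rewrite [X in _ = X * _ + _]k' /cubic1 /a /b; ring.
Qed.

Section ModuloTwentyFive.
Local Notation p := (section 4 0 overpartitions).
Local Notation x := (sigma 3).
Local Notation y := (sub 2 x).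
Local Notation z := (sub 4 x).
Local Notation u := (1 - 5 * x).
Local Notation v := (1 - 5 * y).
Local Notation w := (1 - 5 * z).

Local Notation f1 := (euler).
Local Notation f2 := (sub 2 euler).
Local Notation f4 := (sub 4 euler).
Local Notation f5 := (sub 5 euler).
Local Notation f10 := (sub 10 euler).
Local Notation f20 := (sub 20 euler).

Lemma euler_pow5_1 : cong25 (f1 ^+ 5) (f5 * u).
Proof. by have := euler_pow5_sub 1; rewrite !sub1. Qed.
Lemma euler_pow5_2 : cong25 (f2 ^+ 5) (f10 * v).
Proof. exact: euler_pow5_sub. Qed.
Lemma euler_pow5_4 : cong25 (f4 ^+ 5) (f20 * w).
Proof. exact: euler_pow5_sub. Qed.

Lemma cong25_pow5 (f g t : series) k : cong25 (f ^+ 5) (g * t) ->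
  cong25 (f ^+ (5 * k)) (g ^+ k * t ^+ k).
Proof. by move=> ft; rewrite exprM -exprMn; apply: cong25X. Qed.

Lemma euler_pow50 : cong25 (f1 ^+ 50) (f5 ^+ 10).
Proof.
apply: (cong25_trans (cong25_pow5 10 euler_pow5_1)).
rewrite -[X in cong25 _ X]mulr1; apply: cong25M; first exact: cong25_refl.
rewrite (exprM u 5 2) -[X in cong25 _ X](expr1n _ 2); apply: cong25X; exact: cong25_unit5.
Qed.

(** After f_1^6, f_2^45, f_4^10 and f_1^50 have been reduced by [euler_pow5], the
remaining factors 1 - 5 S(q), 1 - 5 S(q^2), 1 - 5 S(q^4) turn G into the constant
7. *)
Lemma overpartitions_16n4_mod25 : cong25
  (section 4 1 p * sub 5 (euler ^+ 9 * f4 ^+ 2)) (euler * sub 5 (14 * f2 ^+ 9)).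
Proof.
have [e _] := section16_overpartitions.
set p1 := section 4 1 p in e *.
pose G := 7 + 5 * (32 * x + 48 * y + 256 * z).
have GE : 12 * (phi ^+ 4) ^+ 2 - 7 * (phi ^+ 4 * twist phi ^+ 4) + 2 * (twist phi ^+ 4) ^+ 2 = G.
  by rewrite twist_phi8_eisenstein phi8_eisenstein phi4_twist_phi4_eisenstein /G; ring.
have C1 : cong25 (p1 * f1 ^+ 50 * f4 ^+ 10) (2 * f1 ^+ 6 * f2 ^+ 45 * G).
  have g2 := congr1 (sub 2) gauss_phi; rewrite !sub_morph subM in g2.
  exact: theta_quotient_16n4 gauss_phi g2 psi2_twist_phi4 psi_square phi_twist_phi e GE.
have C2 : cong25 (2 * f1 ^+ 6 * f2 ^+ 45 * G) (2 * f1 * f5 * f10 ^+ 9 * (u * v ^+ 9 * G)).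
  apply: (@cong25_trans _ (2 * f1 * (f5 * u) * (f10 ^+ 9 * v ^+ 9) * G)); last first.
    by exists 0; ring.
  apply: (@cong25_trans _ (2 * f1 * f1 ^+ 5 * f2 ^+ 45 * G)); first by exists 0; ring.
  apply: cong25M; last exact: cong25_refl.
  apply: cong25M; last exact: (cong25_pow5 9 euler_pow5_2).
  by apply: cong25M; [exact: cong25_refl | exact: euler_pow5_1].
(* As v^5 = 1, only u v^4 = 1 - 5 x - 20 y is left to be multiplied with G. *)
have C3 : cong25 (u * v ^+ 9 * G) (7 * w ^+ 2).
  apply: (@cong25_trans _ (u * (1 - 5 * (4%:R * y)) * G)).
    apply: cong25M; last exact: cong25_refl.
    apply: cong25M; first exact: cong25_refl.
    rewrite (exprD v 5 4) -[X in cong25 _ X]mul1r.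
    by apply: cong25M; [exact: cong25_unit5 | exact: cong25_unit_exp].
  apply: cong25_trans (cong25_sym _); last first.
    apply: (@cong25M 7 7); [exact: cong25_refl | exact: (cong25_unit_exp z 2)].
  exists (28 * x * y - (x + 4 * y - 20 * x * y) * (32 * x + 48 * y + 256 * z)
    + 5 * x + 4 * y + 54 * z).
  by rewrite /G; ring.
have C4 : cong25 (p1 * f1 ^+ 50 * f4 ^+ 10) (p1 * f5 ^+ 10 * (f20 ^+ 2 * w ^+ 2)).
  apply: cong25M; last exact: (cong25_pow5 2 euler_pow5_4).
  by apply: cong25M; [exact: cong25_refl | exact: euler_pow50].
have wf0 : (f5 * w ^+ 2) 0%N = 1.
  rewrite seriesM0 sub_coef0 euler0 seriesX0 seriesBE series1E series_natME sub_coef0.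
  by rewrite lambert0 mulr0 subr0 expr1n.
apply: (cong25_cancel wf0).
apply: (@cong25_trans _ (p1 * f5 ^+ 10 * (f20 ^+ 2 * w ^+ 2))).
  by exists 0; rewrite !sub_morph !subM; ring.
apply: cong25_trans (cong25_sym C4) _; apply: cong25_trans C1 _.
apply: cong25_trans C2 _.
apply: (@cong25_trans _ (2 * f1 * f5 * f10 ^+ 9 * (7 * w ^+ 2))).
  by apply: cong25M; [exact: cong25_refl | exact: C3].
by exists 0; rewrite !sub_morph !subM; ring.
Qed.

(** The same reduction as in [overpartitions_16n4_mod25]; here the form G' becomes
the constant 2, and the factor q comes from a - b. *)
Lemma overpartitions_16n8_mod25 : cong25
  (section 4 2 p * sub 5 (euler ^+ 10))
  (qv * euler * sub 5 (128 * (euler ^+ 3 * f2 ^+ 3 * f4 ^+ 2))).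
Proof.
have [_ e] := section16_overpartitions.
set p2 := section 4 2 p in e *.
pose G := 2 + 5 * (16 * x + 336 * y - 256 * z).
have GE : 12 * (phi ^+ 4) ^+ 2 - 17 * (phi ^+ 4 * twist phi ^+ 4) + 7 * (twist phi ^+ 4) ^+ 2 = G.
  by rewrite twist_phi8_eisenstein phi8_eisenstein phi4_twist_phi4_eisenstein /G; ring.
have C1 : cong25 (p2 * f1 ^+ 50) (64 * qv * f1 ^+ 16 * f2 ^+ 15 * f4 ^+ 10 * G).
  have g2 := congr1 (sub 2) psi_euler; rewrite !sub_morph subM in g2.
  exact: theta_quotient_16n8 gauss_phi g2 psi2_twist_phi4 psi_square phi4_sub_twist e GE.
have C2 : cong25 (64 * qv * f1 ^+ 16 * f2 ^+ 15 * f4 ^+ 10 * G)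
    (64 * qv * f1 * f5 ^+ 3 * f10 ^+ 3 * f20 ^+ 2 * (u ^+ 3 * v ^+ 3 * w ^+ 2 * G)).
  apply: (@cong25_trans _ (64 * qv * f1 * (f5 ^+ 3 * u ^+ 3) * (f10 ^+ 3 * v ^+ 3) *
    (f20 ^+ 2 * w ^+ 2) * G)); last by exists 0; ring.
  apply: (@cong25_trans _ (64 * qv * f1 * f1 ^+ 15 * f2 ^+ 15 * f4 ^+ 10 * G)).
    by exists 0; ring.
  apply: cong25M; last exact: cong25_refl.
  apply: cong25M; last exact: (cong25_pow5 2 euler_pow5_4).
  apply: cong25M; last exact: (cong25_pow5 3 euler_pow5_2).
  by apply: cong25M; [exact: cong25_refl | exact: (cong25_pow5 3 euler_pow5_1)].
have C3 : cong25 (u ^+ 3 * v ^+ 3 * w ^+ 2 * G) 2.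
  apply: (@cong25_trans _ ((1 + 5 * (- (3 * x) - 3 * y - 2 * z)) * G)).
    apply: cong25M; last exact: cong25_refl.
    apply: (@cong25_trans _ ((1 - 5 * (3%:R * x)) * (1 - 5 * (3%:R * y)) * (1 - 5 * (2%:R * z)))).
      apply: cong25M; last exact: cong25_unit_exp.
      by apply: cong25M; exact: cong25_unit_exp.
    exists (9 * x * y + 6 * x * z + 6 * y * z - 90 * x * y * z); ring.
  apply: cong25_trans (cong25_linear _ _ _ _) _.
  by exists (2 * x + 66 * y - 52 * z); ring.
have C4 : cong25 (p2 * f1 ^+ 50) (p2 * f5 ^+ 10).
  by apply: cong25M; [exact: cong25_refl | exact: euler_pow50].
rewrite sub_exp; apply: cong25_trans (cong25_sym C4) _.
apply: cong25_trans C1 _; apply: cong25_trans C2 _.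
apply: (@cong25_trans _ (64 * qv * f1 * f5 ^+ 3 * f10 ^+ 3 * f20 ^+ 2 * 2)).
  by apply: cong25M; [exact: cong25_refl | exact: C3].
by exists 0; rewrite !sub_morph !subM; ring.
Qed.
End ModuloTwentyFive.

Lemma overpartition_dvd25 n r :
    [\/ r = 8%N, r = 72%N, r = 52%N | r = 68%N] ->
  (25 %| overpartition_number (80 * n + r))%N.
Proof.
have P i j k : (4 * (4 * (5 * n + j) + k) = 80 * n + i)%N ->
    divides 25 (section 5 j (section 4 k (section 4 0 overpartitions))) ->
    (25 %| overpartition_number (80 * n + i))%N.
  move=> e /(_ n); rewrite !sectionE addn0 e.
  by rewrite /coefs /= natz.
have s1 j : (j = 3%N) \/ (j = 4%N) ->
    divides 25 (section 5 j (section 4 1 (section 4 0 overpartitions))).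
  move=> j34; apply: section5_cong overpartitions_16n4_mod25; first by case: j34 => ->.
  - apply: seriesP => m; rewrite sectionE series0E; apply: pentagonal_coef.
    by case: j34 => ->; lia.
  - by rewrite seriesM0 !seriesX0 sub_coef0 euler0 !expr1n.
have s2 j : (j = 0%N) \/ (j = 4%N) ->
    divides 25 (section 5 j (section 4 2 (section 4 0 overpartitions))).
  move=> j04; apply: section5_cong overpartitions_16n8_mod25; first by case: j04 => ->.
  - apply: seriesP => m; rewrite sectionE series0E.
    case e : (5 * m + j)%N => [|i]; rewrite ?qvM0 // qvMS; apply: pentagonal_coef.
    by case: j04 => je; lia.
  - by rewrite seriesX0 euler0 expr1n.
by case=> ->; [apply: (P _ 0 2) | apply: (P _ 4 2) | apply: (P _ 3 1) | apply: (P _ 4 1)];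
  try lia; [apply: s2; left | apply: s2; right | apply: s1; left | apply: s1; right].
Qed.

(** * Congruences modulo 4 and 8 *)

Definition square_poly N : series := \sum_(1 <= s < N.+1) qv ^+ (s ^ 2).
Definition square_series := slimit square_poly.

Lemma square_approx N : approx N square_series (square_poly N).
Proof.
apply: slimit_approx => n; rewrite /square_poly big_nat_recr //= -[qv ^+ _]mulr1.
by apply: approx_qv; nia.
Qed.

Lemma phi_square_series : phi = 1 + 2 * square_series.
Proof.
apply: approx_eq => N; refine (approx_trans (@phi_approx N) _).
apply: approxD => //; apply: approxM => //; exact/approx_sym/(@square_approx N).
Qed.

Lemma square_series_coef n : (forall s, n <> s ^ 2)%N -> square_series n = 0.
Proof.
move=> ns; rewrite (square_approx (leqnn n)) series_sumE big1 // => s _.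
by rewrite qvXE; case: eqP => // /ns.
Qed.

(** The terms of index (i, n - i) and (n - i, i) of a square are equal. *)
Lemma square_coef_even (f : series) n :
  (forall m, n = m.*2 -> f m = 0) -> (2 %| (f ^+ 2) n)%Z.
Proof.
move=> f0; rewrite expr2 seriesME.
rewrite (bigID (fun i : 'I_n.+1 => (i < n - i)%N)) /=.
rewrite [X in _ + X](bigID (fun i : 'I_n.+1 => i == (n - i)%N :> nat)) /=.
rewrite [X in _ + (X + _)]big1 ?add0r; last first.
  move=> i /andP[_ /eqP e]; rewrite (f0 i) ?mul0r //.
  by have := ltn_ord i; rewrite -addnn; move: (nat_of_ord i) e; lia.
rewrite [X in _ + X](reindex_inj rev_ord_inj) /=.
set S := \sum_(i < n.+1 | _) _; set S' := \sum_(i < n.+1 | _) _.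
have -> : S' = S.
  apply: eq_big => [i|i _]; rewrite !subSS.
    by have := ltn_ord i; lia.
  have le_in : (i <= n)%N by rewrite -ltnS ltn_ord.
  by rewrite (subKn le_in) mulrC.
by apply/dvdzP; exists S; ring.
Qed.

(** The geometric series of -2t, stopped at its third term. *)
Lemma overpartitions_expand : exists g, let t := twist square_series in
  overpartitions = 1 - 2 * t + 4 * t ^+ 2 + 8 * g.
Proof.
pose t := twist square_series; exists (- (t ^+ 3 * overpartitions)).
have e : overpartitions * (1 + 2 * t) = 1.
  by rewrite -[RHS]overpartitions_phi phi_square_series !twist_morph.
transitivity (overpartitions * (1 + 2 * t) * (1 - 2 * t + 4 * t ^+ 2) -
  8 * (t ^+ 3 * overpartitions)); first by ring.
by rewrite e /t; ring.
Qed.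

Lemma overpartitions_coef n : (0 < n)%N -> (forall s, n <> s ^ 2)%N ->
  exists c, (overpartition_number n)%:Z = 4 * (twist square_series ^+ 2) n + 8 * c.
Proof.
move=> n0 ns; have [g /= e] := overpartitions_expand; exists (g n).
have := congr1 (fun f : series => f n) e.
rewrite /= !(seriesDE, seriesNE, series_natME) twistE square_series_coef //.
by rewrite series1E (gtn_eqF n0) !mulr0 subr0 add0r -natz.
Qed.

Lemma overpartition_dvd4 n : (0 < n)%N -> (forall s, n <> s ^ 2)%N ->
  (4 %| overpartition_number n)%N.
Proof. by move=> n0 ns; have [c] := overpartitions_coef n0 ns; lia. Qed.

Lemma overpartition_dvd8 n : (0 < n)%N -> (forall s, n <> s ^ 2)%N ->
  (forall s, n <> (s ^ 2).*2)%N -> (8 %| overpartition_number n)%N.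
Proof.
move=> n0 ns n2s; have [c] := overpartitions_coef n0 ns.
have: (2 %| (twist square_series ^+ 2) n)%Z.
  apply: square_coef_even => m nm; rewrite twistE square_series_coef ?mulr0 // => s ms.
  by apply: (n2s s); rewrite nm ms.
by case/dvdzP=> d ->; lia.
Qed.

Lemma square_mod5 s : (s ^ 2 %% 5 \in [:: 0; 1; 4])%N.
Proof.
rewrite -modnXm; have := ltn_pmod s (isT : 0 < 5)%N.
by case: (s %% 5)%N => [|[|[|[|[|]]]]].
Qed.
Lemma square_mod4 s : (s ^ 2 %% 4 \in [:: 0; 1])%N.
Proof.
rewrite -modnXm; have := ltn_pmod s (isT : 0 < 4)%N.
by case: (s %% 4)%N => [|[|[|[|]]]].
Qed.

Lemma nonsquare5 n : (n %% 5 \notin [:: 0; 1; 4])%N -> (forall s, n <> s ^ 2)%N.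
Proof. by move=> n5 s ns; have := square_mod5 s; rewrite -ns (negbTE n5). Qed.

Lemma nonsquare4_double n : (n %% 8 = 4)%N -> (forall s, n <> (s ^ 2).*2)%N.
Proof.
move=> n8 s ns; have := square_mod4 s; rewrite !inE => /orP[] /eqP; lia.
Qed.

(** * The four congruences *)

Close Scope ring_scope.

Theorem theorem3p3 (n : nat) :
  [/\ overpartition_number (80 * n + 8) = 0 %[mod 100],
      overpartition_number (80 * n + 72) = 0 %[mod 100],
      overpartition_number (80 * n + 52) = 0 %[mod 200] &
      overpartition_number (80 * n + 68) = 0 %[mod 200]].
Proof.
have dvd_mod d m : d %| m -> m = 0 %[mod d] by rewrite /dvdn mod0n => /eqP.
have ns r : r %% 5 \notin [:: 0; 1; 4] -> forall s, 80 * n + r <> s ^ 2.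
  by move=> r5; apply: nonsquare5; rewrite -modnDml -modnMml mul0n.
have n2s r : r %% 8 = 4 -> forall s, 80 * n + r <> (s ^ 2).*2.
  by move=> r8; apply: nonsquare4_double; rewrite -modnDml -modnMml mul0n.
split; apply: dvd_mod.
- rewrite (@Gauss_dvd 4 25) // overpartition_dvd25 ?andbT; last by constructor.
  by apply: overpartition_dvd4; [lia | apply: ns].
- rewrite (@Gauss_dvd 4 25) // overpartition_dvd25 ?andbT; last by constructor.
  by apply: overpartition_dvd4; [lia | apply: ns].
- rewrite (@Gauss_dvd 8 25) // overpartition_dvd25 ?andbT; last by constructor.
  by apply: overpartition_dvd8; [lia | apply: ns | apply: n2s].
- rewrite (@Gauss_dvd 8 25) // overpartition_dvd25 ?andbT; last by constructor.
  by apply: overpartition_dvd8; [lia | apply: ns | apply: n2s].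
Qed.
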